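(* Let $\xi$ be a Gaussian random element in a real separable Hilbert space $\mathbb{H}$ with zero mean and covariance operator $\Sigma$, and let $\lambda_1\ge\lambda_2\ge\cdots$ be the eigenvalues (with multiplicity) of $\Sigma$. Then for arbitrary $x>0$, $\Delta>0$ and any $\lambda>\lambda_1$, $$\mathbb{P}\bigl(x<\|\xi\|^2<x+\Delta\bigr)\le C_1\,\Delta,\qquad C_1=\frac{e^{-x/(2\lambda)}}{\sqrt{\lambda_1\lambda_2}}\prod_{j=3}^{\infty}\bigl(1-\lambda_j/\lambda\bigr)^{-1/2}.$$ In particular, $$\sup_{x>0}\mathbb{P}\bigl(x<\|\xi\|^2<x+\Delta\bigr)\le\frac{\Delta}{\sqrt{\lambda_1\lambda_2}}.$$
   Context: $\|\cdot\|$ is the norm of $\mathbb{H}$. If $\mathbb{H}$ is finite-dimensional, the eigenvalue sequence is extended by zeros. The bounds are meaningful when $\lambda_2>0$ (otherwise the right-hand sides are understood as $+\infty$). *)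

(* Defs.v *)
From HB Require Import structures.
From mathcomp Require Import all_boot all_order all_algebra.
From mathcomp Require Import all_classical all_reals all_analysis.

Set Implicit Arguments.
Unset Strict Implicit.
Unset Printing Implicit Defensive.

Import Order.TTheory GRing.Theory Num.Theory.
Import numFieldNormedType.Exports.

Local Open Scope classical_set_scope.
Local Open Scope ring_scope.

Definition separable_space (T : topologicalType) : Prop :=
  exists2 D : set T, countable D & dense D.

(* A real separable Hilbert space is a complete normed space over R whose norm
   comes from the inner product [ip], with a countable dense subset. *)
Definition separable_hilbert (R : realType) (H : completeNormedModType R)
    (ip : {dot H for @idfun R}) : Prop :=
  (forall u : H, `|u| ^+ 2 = ip u u) /\ separable_space H.

(* Normal law on the line with mean m and standard deviation s, degenerate
   (Dirac) for s = 0; [normal_prob m 0] is a junk value in the library. *)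
Definition gaussian_law (R : realType) (m s : R) (A : set R) : \bar R :=
  if s == 0 then \d_m A else normal_prob m s A.

Section random_elements.
Context {d : measure_display} {T : measurableType d} {R : realType}.
Context {H : completeNormedModType R}.
Variables (P : probability T R) (ip : {dot H for @idfun R}).

(* Borel measurable, and every one-dimensional marginal is a (possibly
   degenerate) normal law. *)
Definition gaussian_element (xi : T -> H) : Prop :=
  measurable_fun [set: T] (xi : T -> g_sigma_algebraType (@open H)) /\
  forall h : H, exists m s : R, forall A : set R, measurable A ->
    P ((fun w => ip (xi w) h) @^-1` A) = gaussian_law m s A.

Definition zero_mean (xi : T -> H) : Prop :=
  forall h : H, ('E_P[fun w => ip (xi w) h] = 0)%E.

Definition covariance_operator (xi : T -> H) (Sigma : {linear H -> H}) : Prop :=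
  continuous Sigma /\
  forall u v : H,
    covariance P (fun w => ip (xi w) u) (fun w => ip (xi w) v)
    = (ip (Sigma u) v)%:E.

End random_elements.

Definition eigen_subspace (R : realType) (H : completeNormedModType R)
    (A : {linear H -> H}) (a : R) : set H :=
  [set u | A u = a *: u].

Definition has_dim (R : realType) (V : lmodType R) (E : set V) (n : nat) : Prop :=
  exists e : 'I_n -> V,
    (forall c : 'I_n -> R, \sum_(i < n) c i *: e i = 0 -> forall i, c i = 0) /\
    E = [set \sum_(i < n) c i *: e i | c in [set: 'I_n -> R]].

(* [lam] lists, in nonincreasing order, the nonzero eigenvalues of A, each
   repeated according to the dimension of its eigenspace, and continues with
   zeros when there are finitely many of them.  When A is positive the condition
   at a < 0 says that [lam] has no negative entry.  With infinitely many nonzero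
   eigenvalues, 0 does not appear in [lam] even if A has a kernel. *)
Definition eigenvalue_sequence (R : realType) (H : completeNormedModType R)
    (A : {linear H -> H}) (lam : R^nat) : Prop :=
  nonincreasing_seq lam /\
  forall a : R, a != 0 ->
    exists2 n : nat, ([set j | lam j = a] #= `I_n)%card & has_dim (eigen_subspace A a) n.

(* Indices are shifted by one: [lam 0], [lam 1], ... are lambda_1, lambda_2, ...
   so the product over j >= 3 is the one over indices >= 2. *)
Definition tail_prod (R : realType) (lam : R^nat) (l : R) : R^nat :=
  fun n => \prod_(2 <= j < n) (1 - lam j / l) `^ (- 2^-1).

(* The division is the one of extended reals, for which the inverse of 0 is
   +oo; hence C1 = +oo when lam 1 = 0. *)
Definition C1 (R : realType) (lam : R^nat) (l x : R) : \bar R :=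
  ((expR (- (x / (2 * l))))%:E / (Num.sqrt (lam 0%N * lam 1%N)%R)%:E
   * (limn (tail_prod lam l))%:E)%E.

(* Main.v *)
Require Import Defs.
From HB Require Import structures.
From mathcomp Require Import all_boot all_order all_algebra.
From mathcomp Require Import finmap.
From mathcomp Require Import all_classical all_reals all_analysis.
From mathcomp Require Import measurable_realfun.
From mathcomp Require Import ring lra.

Set Implicit Arguments.
Unset Strict Implicit.
Unset Printing Implicit Defensive.

Import Order.TTheory GRing.Theory Num.Theory.
Import numFieldNormedType.Exports.

Local Open Scope classical_set_scope.
Local Open Scope ring_scope.

(** Let [e j] be orthonormal eigenvectors of the covariance for the eigenvalues
    [lam j]. The coordinates [<xi, e j>] are independent centred Gaussians of
    variance [lam j], and [|xi| ^ 2] is the sum of their squares. Freeze all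
    coordinates but the first two, with frozen sum [r]. What remains is the
    probability that a planar Gaussian vector with variances [lam 0, lam 1]
    lies in the set [x - r < y ^ 2 + z ^ 2 < x - r + Delta], an annulus or a
    disc. Its area is at most [pi Delta], and on it the density is at most
    [exp (- max (x - r, 0) / (2 lam 0))] over [2 pi sqrt (lam 0 lam 1)]. With
    [pi] replaced by the area [4] of a square around the unit disc this still
    gives [gauss_annulus], because [4 / (2 pi) <= 1]. Bounding the exponential by one gives the second claim. Bounding it
    by [exp (- (x - r) / (2 l))] and integrating [exp (r / (2 l))], a product of
    one-dimensional Gaussian integrals, gives the first
    ([sumsq_concentration], [sumsq_concentration_exp]).

    Being Gaussian means here that every one-dimensional marginal is normal, so
    independence of the coordinates has to be extracted from the laws of linear
    combinations. The identity [exp (- t x ^ 2 / 2) = E cos (sqrt t x Z)], with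
    [Z] standard Gaussian, linearises the squares one at a time and yields the
    Laplace transform of a sum of squares ([Rintegral_cos_sumsq]). For a
    nonnegative variable [S] the transform at integer multiples gives the moments
    of [exp (- S)], and moments determine the law of a variable with values in
    the unit interval by Bernstein approximation ([moments_eq_interval]). Hence
    one square may be exchanged for that of an independent Gaussian
    ([integral_sumsq_cons]), which is all the independence needed.

    That the squares of the coordinates add up to [|xi| ^ 2] requires the
    eigenvectors to be complete for [xi]. Power iteration along a Gaussian
    element takes the place of a compactness argument. Let [m] be the supremum of the quadratic form of a
    Gaussian covariance [A], and suppose that [m > 0]. Even powers of [A / m]
    applied to any vector converge, to a fixed vector. If all those limits along
    a Gaussian element [zeta] of covariance [A] were zero, the Laplace
    transforms of the norms of these iterates would tend to one, whereas they
    are at most [(1 + m / 4) ^ (- 1 / 2)]. So [m] is an eigenvalue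
    ([covariance_eigenvector]). Applied to the residual of [xi] after its first
    [n] coordinates this bounds the residual covariance by [lam n], which tends
    to zero because the positivity of [E exp (- |xi| ^ 2 / 2)] makes the
    eigenvalues summable. The residuals converge pointwise, hence almost surely
    to zero ([ae_energy_cvg]). As the partial sums of squares increase to
    [|xi| ^ 2], the bounds for finitely many coordinates pass to the limit
    ([prob_oo_limit_le]). *)

(** * Affine images and the standard Gaussian law *)

Definition image_measure d d' (T1 : measurableType d) (T2 : measurableType d')
    (R : realType) (m : {measure set T1 -> \bar R}) (f : T1 -> T2)
    (mf : measurable_fun setT f) : {measure set T2 -> \bar R} :=
  measure_function_pushforward__canonical__measure_function_Measure m mf.

Section affine.
Variable R : realType.
Local Notation mu := (@lebesgue_measure R).

Lemma measurable_affine (m s : R) :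
  measurable_fun [set: measurableTypeR R]
    (fun x : measurableTypeR R => (m + s * x)%R : measurableTypeR R).
Proof. by apply: measurable_funD => //; exact: measurable_funM. Qed.

(** Both sides are measures that agree on half-open intervals. *)
Lemma lebesgue_measure_affine (m s : R) (A : set (measurableTypeR R)) :
  s != 0 -> measurable A ->
  mu A = (`|s|%:E * mu ((fun x => (m + s * x)%R) @^-1` A))%E.
Proof.
move=> s0 mA.
pose nu : {measure set (measurableTypeR R) -> \bar R} :=
  mscale (NngNum (normr_ge0 s)) (image_measure mu (measurable_affine m s)).
suff : forall X, ocitv X -> mu X = nu X.
  by move=> /(@lebesgue_measure_unique R nu) /(_ _ mA) ->.
move=> _ [[a b] _ <-] /=; rewrite /mscale/= /pushforward/=.
move: s0; rewrite neq_lt => /orP[s0|s0].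
- have -> : (fun x : R => m + s * x) @^-1` `]a, b]%classic
      = `[(b - m) / s, (a - m) / s[%classic.
    apply/seteqP; split => x /=; rewrite !in_itv/= ltr_ndivlMr// ler_ndivrMr//;
    by rewrite ltrBlDl lerBrDl (mulrC x) andbC.
  rewrite !lebesgue_measure_itv/= !lte_fin ltr_nM2r ?invr_lt0// ltrD2r.
  case: ifPn => _; last by rewrite mule0.
  rewrite ltr0_norm// -!EFinD -EFinM; congr EFin.
  by field; rewrite lt_eqF.
- have -> : (fun x : R => m + s * x) @^-1` `]a, b]%classic
      = `](a - m) / s, (b - m) / s]%classic.
    apply/seteqP; split => x /=; rewrite !in_itv/= ltr_pdivrMr// ler_pdivlMr//;
    by rewrite ltrBlDl lerBrDl (mulrC x).
  rewrite !lebesgue_measure_itv/= !lte_fin ltr_pM2r ?invr_gt0// ltrD2r.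
  case: ifPn => _; last by rewrite mule0.
  rewrite gtr0_norm// -!EFinD -EFinM; congr EFin.
  by field; rewrite gt_eqF.
Qed.

Lemma ge0_integral_affine (m s : R) (f : measurableTypeR R -> \bar R) :
  s != 0 -> measurable_fun setT f -> (forall x, 0 <= f x)%E ->
  (\int[mu]_x f x = `|s|%:E * \int[mu]_x f (m + s * x)%R)%E.
Proof.
move=> s0 mf f0.
pose nu : {measure set (measurableTypeR R) -> \bar R} :=
  mscale (NngNum (normr_ge0 s)) (image_measure mu (measurable_affine m s)).
rewrite (eq_measure_integral nu)/=; last first.
  by move=> A mA _; exact: lebesgue_measure_affine.
rewrite ge0_integral_mscale//; congr (_ * _)%E.
rewrite ge0_integral_pushforward//; exact: measurable_affine.
Qed.

End affine.

Section normal_integral.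
Variables (R : realType) (m s : R).
Local Notation mu := (@lebesgue_measure R).
Import HBNNSimple.

Let integral_normal_prob_indic (E : set (measurableTypeR R)) : measurable E ->
  (\int[normal_prob m s]_x (\1_E x)%:E =
   \int[mu]_x ((\1_E x)%:E * (normal_pdf m s x)%:E))%E.
Proof.
move=> mE; rewrite integral_indic//= setIT /normal_prob integral_mkcond.
apply: eq_integral => x _; rewrite patchE indicE; case: ifPn => xE.
  by rewrite mul1e.
by rewrite mul0e.
Qed.

Let mpdf : measurable_fun [set: measurableTypeR R]
  (fun x => (normal_pdf m s x)%:E).
Proof. by apply/measurable_EFinP; exact: measurable_normal_pdf. Qed.

Let pdf0 x : (0 <= (normal_pdf m s x)%:E)%E.
Proof. by rewrite lee_fin normal_pdf_ge0. Qed.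

Let integral_normal_prob_nnsfun (f : {nnsfun measurableTypeR R >-> R}) :
  (\int[normal_prob m s]_x (f x)%:E =
   \int[mu]_x ((f x)%:E * (normal_pdf m s x)%:E))%E.
Proof.
under [LHS]eq_integral do rewrite fimfunE -fsumEFin//.
rewrite [LHS]ge0_integral_fsum//; last 2 first.
  - by move=> r; exact/measurable_EFinP/measurableT_comp.
  - by move=> n x _; rewrite EFinM nnfun_muleindic_ge0.
under [RHS]eq_integral.
  move=> x xD; rewrite fimfunE -fsumEFin// ge0_mule_fsuml; last first.
    by move=> r; rewrite EFinM nnfun_muleindic_ge0.
  over.
rewrite [RHS]ge0_integral_fsum//; last 2 first.
  - move=> r; apply: emeasurable_funM => //.
    by apply/measurable_EFinP; do 2 apply/measurableT_comp => //.
  - by move=> n x _; rewrite mule_ge0// EFinM nnfun_muleindic_ge0.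
apply: eq_fsbigr => r rf.
rewrite integralZl_indic_nnsfun//= integral_normal_prob_indic//.
have [r0|r0] := leP 0%R r.
  rewrite -ge0_integralZl//=; last 2 first.
    - apply: emeasurable_funM => //.
      by apply/measurable_EFinP; exact: measurable_indic.
    - by move=> x _; rewrite mule_ge0// lee_fin.
  by apply: eq_integral => x _; rewrite EFinM muleA.
have -> : f @^-1` [set r] = set0.
  by apply/seteqP; split => // x /= fxr; move: r0; rewrite -fxr ltNge fun_ge0.
under eq_integral do rewrite indic0 mul0e.
under [RHS]eq_integral do rewrite indic0 mulr0 mul0e.
by rewrite !integral0 mule0.
Qed.

Lemma ge0_integral_normal_prob (f : measurableTypeR R -> \bar R) :
  measurable_fun setT f -> (forall x, 0 <= f x)%E ->
  (\int[normal_prob m s]_x f x = \int[mu]_x (f x * (normal_pdf m s x)%:E))%E.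
Proof.
move=> mf f0.
pose f_ := nnsfun_approx measurableT mf.
transitivity (lim (\int[normal_prob m s]_x (f_ n x)%:E @[n --> \oo])%E).
  rewrite -monotone_convergence//=.
  - apply: eq_integral => ? /[!inE] xD; apply/esym/cvg_lim => //=.
    exact: cvg_nnsfun_approx.
  - by move=> n; exact/measurable_EFinP/measurable_funTS.
  - by move=> n ? _; rewrite lee_fin.
  - by move=> ? _ ? ? mn; rewrite lee_fin; exact/lefP/nd_nnsfun_approx.
rewrite [RHS](_ : _ = lim
    (\int[mu]_x ((f_ n x)%:E * (normal_pdf m s x)%:E) @[n --> \oo])%E); last first.
  rewrite -monotone_convergence//=.
  - apply: eq_integral => x /[!inE] xD; apply/esym/cvg_lim => //.
    by apply: cvgeZr => //; exact: cvg_nnsfun_approx.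
  - by move=> n; apply: emeasurable_funM => //; exact/measurable_EFinP/measurable_funTS.
  - by move=> n ? _; rewrite mule_ge0// lee_fin.
  - move=> ? _ ? ? ?; rewrite lee_wpmul2r// lee_fin; exact/lefP/nd_nnsfun_approx.
by apply: congr_lim; apply/funext => n /=; exact: integral_normal_prob_nnsfun.
Qed.

End normal_integral.

Lemma integrable_mulrl d (T : measurableType d) (R : realType)
    (mu : {measure set T -> \bar R}) (f : T -> R) (k : R) :
  mu.-integrable setT (fun x => (f x)%:E) ->
  mu.-integrable setT (fun x => (k * f x)%:E).
Proof.
by move=> fi; under eq_fun do rewrite EFinM; exact: integrableZl.
Qed.

Lemma integral_prob_cst d (T : measurableType d) (R : realType)
  (P : probability T R) (r : R) : (\int[P]_w r%:E = r%:E)%E.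
Proof.
by have := expectation_cst P r; rewrite unlock.
Qed.

Lemma Rintegral_prob_cst d (T : measurableType d) (R : realType)
  (P : probability T R) (r : R) : \int[P]_w r = r.
Proof. by rewrite /Rintegral integral_prob_cst. Qed.

(** The standard Gaussian law, kept opaque: otherwise comparing two integrals
    with respect to Gaussian laws unfolds their densities. *)
Lemma gauss_subproof (R : realType) :
  {mu : probability (measurableTypeR R) R | forall A, mu A = normal_prob 0 1 A}.
Proof. by exists (normal_prob 0 1). Qed.

Definition gauss (R : realType) : probability (measurableTypeR R) R :=
  sval (gauss_subproof R).

Lemma gaussE (R : realType) (A : set (measurableTypeR R)) :
  gauss R A = normal_prob 0 1 A.
Proof. exact: (svalP (gauss_subproof R)). Qed.

Section standard_normal.
Variable R : realType.
Local Notation mu := (@lebesgue_measure R).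
Local Notation gam := (gauss R).

Lemma normal_pdf_affine (m s x : R) : s != 0 ->
  `|s| * normal_pdf m s (m + s * x) = normal_pdf 0 1 x.
Proof.
move=> s0; rewrite !normal_pdfE ?oner_eq0//.
rewrite /normal_peak /normal_fun mulrA; congr (_ * expR _).
  rewrite expr1n mul1r -!mulrnAr sqrtrM ?sqr_ge0// sqrtr_sqr invfM.
  by rewrite mulrA divff ?normr_eq0// mul1r.
by field.
Qed.

Lemma gaussian_lawE (m s : R) (A : set (measurableTypeR R)) : measurable A ->
  gaussian_law m s A = gam ((fun x => (m + s * x)%R) @^-1` A).
Proof.
move=> mA; rewrite /gaussian_law; case: ifPn => [/eqP ->|s0].
  rewrite diracE; have [mA'|mA'] := boolP (m \in A).
    rewrite (_ : _ @^-1` _ = setT) ?probability_setT//.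
    by apply/seteqP; split => // x _ /=; rewrite mul0r addr0 -inE.
  rewrite (_ : _ @^-1` _ = set0) ?measure0//.
  apply/seteqP; split => x //=; rewrite mul0r addr0 => /mem_set.
  by rewrite (negbTE mA').
have mpdfA : measurable_fun [set: measurableTypeR R]
    ((fun x : measurableTypeR R => (normal_pdf m s x)%:E) \_ A).
  apply/(measurable_restrictT _ mA); apply: measurable_funTS.
  by apply/measurable_EFinP; exact: measurable_normal_pdf.
have pdfA0 x : (0 <= ((fun x : measurableTypeR R => (normal_pdf m s x)%:E) \_ A) x)%E.
  by rewrite erestrict_ge0// => y _; rewrite lee_fin normal_pdf_ge0.
rewrite gaussE /normal_prob [LHS]integral_mkcond (@ge0_integral_affine R m s _ s0)//.
rewrite -ge0_integralZl//=; last first.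
  by apply: (measurableT_comp mpdfA); exact: measurable_affine.
rewrite [RHS]integral_mkcond; apply: eq_integral => x _.
rewrite !patchE (_ : (x \in _ @^-1` A) = (m + s * x \in A)); last first.
  by apply/idP/idP; rewrite !inE.
case: ifPn => _.
  by rewrite -EFinM normal_pdf_affine.
by rewrite mule0.
Qed.

Lemma ge0_integral_gauss (f : measurableTypeR R -> \bar R) :
  measurable_fun setT f -> (forall x, 0 <= f x)%E ->
  (\int[gam]_x f x = \int[mu]_x (f x * (normal_pdf 0 1 x)%:E))%E.
Proof.
move=> mf f0; rewrite -ge0_integral_normal_prob//.
by apply: eq_measure_integral => A _ _; exact: gaussE.
Qed.

End standard_normal.

Section standard_normal_integrals.
Variable R : realType.
Local Notation gam := (gauss R).
Implicit Types (a b c s t z : R).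

Lemma ge0_integral_normal_affine m s (f : measurableTypeR R -> \bar R) : s != 0 ->
  measurable_fun setT f -> (forall x, 0 <= f x)%E ->
  (\int[normal_prob m s]_x f x = \int[gam]_x f (m + s * x)%R)%E.
Proof.
move=> s0 mf f0.
transitivity (\int[image_measure gam (measurable_affine m s)]_x f x)%E.
  apply: eq_measure_integral => A mA _.
  apply: etrans (gaussian_lawE m s mA); by rewrite /gaussian_law (negbTE s0).
by rewrite ge0_integral_pushforward//; exact: measurable_affine.
Qed.

Lemma ge0_integral_gauss_sym (f : measurableTypeR R -> \bar R) :
  measurable_fun setT f -> (forall x, 0 <= f x)%E ->
  (\int[gam]_x f (- x)%R = \int[gam]_x f x)%E.
Proof.
move=> mf f0; transitivity (\int[normal_prob 0 (-1)]_x f x)%E.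
  rewrite ge0_integral_normal_affine ?oppr_eq0//.
  by apply: eq_integral => x _; rewrite add0r mulN1r.
apply: eq_measure_integral => A mA _; apply: etrans (esym (gaussE A)).
apply: eq_integral => x _.
by rewrite !normal_pdfE ?oppr_eq0// /normal_peak /normal_fun sqrrN.
Qed.

Lemma integral_gauss_sym (f : measurableTypeR R -> \bar R) :
  measurable_fun setT f ->
  (\int[gam]_x f (- x)%R = \int[gam]_x f x)%E.
Proof.
move=> mf; rewrite integralE [RHS]integralE.
apply: (f_equal2 (fun x y => x - y)%E).
  apply: etrans (ge0_integral_gauss_sym (measurable_funepos mf) (funepos_ge0 f)).
  by apply: eq_integral => x _; rewrite ?funeposE ?funenegE.
apply: etrans (ge0_integral_gauss_sym (measurable_funeneg mf) (funeneg_ge0 f)).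
by apply: eq_integral => x _; rewrite ?funeposE ?funenegE.
Qed.

(** The exponential is the density of the translate of the Gaussian law by [b]
    with respect to the Gaussian law itself. *)
Lemma ge0_integral_gauss_shift b (f : measurableTypeR R -> R) :
  measurable_fun setT f -> (forall x, 0 <= f x) ->
  (\int[gam]_x (f x * expR (b * x - b ^+ 2 / 2))%:E
   = \int[gam]_x (f (b + x))%:E)%E.
Proof.
move=> mf f0.
have mE : measurable_fun [set: measurableTypeR R]
    (fun x => f x * expR (b * x - b ^+ 2 / 2)).
  apply: measurable_funM => //; apply: measurableT_comp => //.
  by apply: measurable_funB => //; exact: measurable_funM.
transitivity (\int[normal_prob b 1]_x (f x)%:E)%E; last first.
  rewrite ge0_integral_normal_affine//.
  - by apply: eq_integral => x _; rewrite mul1r.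
  - exact/measurable_EFinP.
have mE' : measurable_fun [set: measurableTypeR R]
    (fun x => (f x * expR (b * x - b ^+ 2 / 2))%:E) by exact/measurable_EFinP.
have mf' : measurable_fun [set: measurableTypeR R] (fun x => (f x)%:E).
  exact/measurable_EFinP.
apply: etrans (ge0_integral_gauss mE' _) _.
  by move=> x; rewrite lee_fin mulr_ge0 ?expR_ge0.
have f0' x : (0 <= (f x)%:E)%E by rewrite lee_fin.
apply: etrans; last by apply: esym; apply: (ge0_integral_normal_prob b 1 mf' f0').
apply: eq_integral => x _; rewrite -!EFinM; congr EFin.
rewrite -mulrA; congr (_ * _).
rewrite !normal_pdfE// mulrCA; congr (_ * _).
by rewrite /normal_fun -expRD; congr expR; field.
Qed.

Lemma integral_gauss_shift b (f : measurableTypeR R -> R) : measurable_fun setT f ->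
  (\int[gam]_x (f x * expR (b * x - b ^+ 2 / 2))%:E
   = \int[gam]_x (f (b + x))%:E)%E.
Proof.
move=> mf; rewrite integralE [RHS]integralE.
apply: (f_equal2 (fun x y => x - y)%E).
- transitivity (\int[gam]_x (f^\+ x * expR (b * x - b ^+ 2 / 2))%:E)%E.
    apply: eq_integral => x _; rewrite funeposE /funrpos -EFin_max; congr EFin.
    by rewrite maxr_pMl ?expR_ge0// mul0r.
  rewrite ge0_integral_gauss_shift//.
  - by apply: eq_integral => x _; rewrite funeposE /funrpos -EFin_max.
  - exact: measurable_funrpos.
- transitivity (\int[gam]_x (f^\- x * expR (b * x - b ^+ 2 / 2))%:E)%E.
    apply: eq_integral => x _; rewrite funenegE /funrneg -EFinN -EFin_max; congr EFin.
    by rewrite maxr_pMl ?expR_ge0// mul0r mulNr.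
  rewrite ge0_integral_gauss_shift//.
  - by apply: eq_integral => x _; rewrite funenegE /funrneg -EFinN -EFin_max.
  - exact: measurable_funrneg.
Qed.

Lemma measurable_expRM b : measurable_fun [set: measurableTypeR R] (fun x : measurableTypeR R => expR (b * x)).
Proof. by apply: measurableT_comp => //; exact: measurable_funM. Qed.

Lemma integral_gauss_expR b : (\int[gam]_x (expR (b * x))%:E = (expR (b ^+ 2 / 2))%:E)%E.
Proof.
have := @ge0_integral_gauss_shift b (cst 1) (measurable_cst _) (fun=> ler01).
under eq_integral do rewrite mul1r expRD EFinM.
rewrite ge0_integralZr//; last first.
  by apply/measurable_EFinP; exact: measurable_expRM.
rewrite [X in _ = X](_ : _ = 1%E) => [h|]; last first.
  by rewrite /cst integral_prob_cst.
have := congr1 (fun y => y * (expR (b ^+ 2 / 2))%:E)%E h.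
by rewrite -muleA -EFinM -expRD addNr expR0 mule1 mul1e.
Qed.

Lemma gauss_integrable_expR c :
  gam.-integrable setT (fun x => (expR (c * `|x|))%:E).
Proof.
refine (@le_integrable _ _ _ gam setT measurableT _
   (fun x => (expR (c * x))%:E + (expR ((- c) * x))%:E)%E _ _ _).
- apply/measurable_EFinP; apply: measurableT_comp => //.
  by apply: measurable_funM => //; exact: measurableT_comp.
- move=> x _; rewrite -EFinD/= lee_fin (ger0_norm (expR_ge0 _)) (ger0_norm (addr_ge0 (expR_ge0 _) (expR_ge0 _))).
  have [x0|x0] := leP 0 x.
    by rewrite (ger0_norm x0) lerDl expR_ge0.
  by rewrite (ltr0_norm x0) mulrN -mulNr lerDr expR_ge0.
have ie b : gam.-integrable setT (fun x => (expR (b * x))%:E).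
  apply/integrableP; split; first by apply/measurable_EFinP; exact: measurable_expRM.
  under eq_integral do rewrite gee0_abs ?lee_fin ?expR_ge0//.
  by rewrite integral_gauss_expR ltry.
exact: (integrableD measurableT (ie c) (ie (- c))).
Qed.

Lemma gauss_integrable (f : measurableTypeR R -> R) K c : measurable_fun setT f ->
  (forall x, `|f x| <= K * expR (c * `|x|)) ->
  gam.-integrable setT (EFin \o f).
Proof.
move=> mf fK.
refine (@le_integrable _ _ _ gam setT measurableT _
   (fun x => K%:E * (expR (c * `|x|))%:E)%E _ _ _).
- exact/measurable_EFinP.
- by move=> x _; rewrite -EFinM/= lee_fin (le_trans (fK x))// ler_norm.
by apply: integrableZl => //; exact: gauss_integrable_expR.
Qed.

Lemma le_expR (x : R) : x <= expR x.
Proof. by rewrite (le_trans _ (expR_ge1Dx x))// lerDr ler01. Qed.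

End standard_normal_integrals.

(** * Stein's identity and Gaussian integrals *)

Section stein.
Variable R : realType.
Local Notation gam := (gauss R).
Implicit Types (a b c s t z : R).

(** Differentiation under the integral sign; the exponential growth of [g] is
    absorbed by the integrability of every [exp (c |x|)]. *)
Lemma stein_derive (g : measurableTypeR R -> R) K c : measurable_fun setT g ->
  (forall x, `|g x| <= K * expR (c * `|x|)) ->
  derive1 (fun b => \int[gam]_x (g x * expR (b * x))) 0 = \int[gam]_x (g x * x).
Proof.
move=> mg gK.
have K0 : 0 <= K.
  by have := le_trans (normr_ge0 _) (gK 0); rewrite normr0 mulr0 expR0 mulr1.
pose f b x := g x * expR (b * x).
have df b x : is_derive b (1 : R) (f^~ x) (g x * x * expR (b * x)).
  rewrite /f; apply: is_derive_eq.
  by rewrite /GRing.scale/=; ring.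
have Ib b : `|b| < 1 -> forall x, expR (b * x) <= expR `|x|.
  move=> b1 x; rewrite ler_expR (le_trans (ler_norm _))// normrM.
  by rewrite ler_piMl// ltW.
have I1 b : `]-1, 1[%classic b -> `|b| < 1 by rewrite /= in_itv/= ltr_norml.
rewrite (@differentiation_under_integral R _ _ gam f setT measurableT 0 (-1) 1
  _ _ _ (fun x => K * expR ((c + 2) * `|x|))).
- apply: eq_Rintegral => x _; rewrite partial1of2E.
  by rewrite (@derive_val _ _ _ _ _ _ _ (df 0 x)) mul0r expR0 mulr1.
- by rewrite /= in_itv/= ltrN10 ltr01.
- move=> b /I1 b1; apply: (@gauss_integrable _ _ K (c + 1)).
    by apply: measurable_funM => //; exact: measurable_expRM.
  move=> x; rewrite normrM (ger0_norm (expR_ge0 _)) mulrDl expRD mulrA mul1r.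
  by rewrite ler_pM ?expR_ge0// Ib.
- by move=> b x _ _; have [] := df b x.
- by move=> y; rewrite mulr_ge0 ?expR_ge0.
- apply: (@gauss_integrable _ _ K (c + 2)).
    apply: measurable_funM => //; apply: measurableT_comp => //.
    by apply: measurable_funM => //; exact: measurableT_comp.
  by move=> x; rewrite ger0_norm// mulr_ge0 ?expR_ge0.
- move=> b x /I1 b1 _; rewrite partial1of2E (@derive_val _ _ _ _ _ _ _ (df b x)).
  rewrite !normrM (ger0_norm (expR_ge0 _)).
  rewrite -[leLHS]mulrA mulrDl expRD [leRHS]mulrA; apply: ler_pM => //.
  rewrite (_ : 2 * `|x| = `|x| + `|x|); last by rewrite mulr_natl mulr2n.
  by rewrite expRD ler_pM ?expR_ge0// ?le_expR// Ib.
Qed.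

(** Tilting the law by [exp (b x)] is the same as translating it by [b]: the
    derivative at zero of the tilted mean is then that of the translated one. *)
Lemma stein (g : measurableTypeR R -> R) K c : measurable_fun setT g ->
  (forall x, `|g x| <= K * expR (c * `|x|)) ->
  \int[gam]_x (g x * x) =
  derive1 (fun b => expR (b ^+ 2 / 2) * \int[gam]_x (g (b + x))) 0.
Proof.
move=> mg gK; rewrite -(stein_derive mg gK); congr (derive1 _ 0).
apply/funext => b; rewrite /Rintegral -integral_gauss_shift//.
rewrite -[X in _ * X]/(Rintegral _ _ _) -RintegralZl//.
  apply: eq_Rintegral => x _; rewrite mulrCA -expRD; congr (_ * expR _); ring.
have -> : (EFin \o (fun x => g x * expR (b * x - b ^+ 2 / 2))) =
  (fun x => (expR (- (b ^+ 2 / 2)))%:E * (g x * expR (b * x))%:E)%E.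
  by apply/funext => x /=; rewrite -EFinM expRD; congr EFin; ring.
apply: integrableZl => //.
apply: (@gauss_integrable _ _ K (c + `|b|)).
  by apply: measurable_funM => //; exact: measurable_expRM.
move=> x; rewrite normrM (ger0_norm (expR_ge0 _)) mulrDl expRD mulrA.
by rewrite ler_pM ?expR_ge0// ler_expR -normrM ler_norm.
Qed.

Lemma Rintegral_gauss_odd (f : measurableTypeR R -> R) : measurable_fun setT f ->
  (forall x, f (- x) = - f x) -> gam.-integrable setT (EFin \o f) ->
  \int[gam]_x f x = 0.
Proof.
move=> mf fN fi.
have : \int[gam]_x f x = - \int[gam]_x f x.
  rewrite -mulN1r -RintegralZl// /Rintegral -integral_gauss_sym.
    by congr fine; apply: eq_integral => x _; rewrite fN mulN1r.
  exact/measurable_EFinP.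
by move=> /eqP; rewrite -addr_eq0 -mulr2n mulrn_eq0 => /eqP.
Qed.

Lemma gauss_integrable_id : gam.-integrable setT (fun x : R => x%:E).
Proof.
apply: (@gauss_integrable _ id 1 1) => // x.
by rewrite !mul1r le_expR.
Qed.

Lemma Rintegral_gauss_id : \int[gam]_x x = 0.
Proof. by apply: Rintegral_gauss_odd => //; exact: gauss_integrable_id. Qed.

Lemma Rintegral_gauss_sqr : \int[gam]_x (x ^+ 2) = 1.
Proof.
under eq_Rintegral do rewrite expr2.
rewrite (@stein id 1 1) //; last by move=> x; rewrite !mul1r le_expR.
rewrite (_ : (fun _ => _) = (fun b => expR (b ^+ 2 / 2) * b)); last first.
  apply/funext => b; congr (_ * _); rewrite RintegralD//; last 2 first.
  - exact: (finite_measure_integrable_cst gam b measurableT).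
  - exact: gauss_integrable_id.
  by rewrite Rintegral_gauss_id addr0 Rintegral_prob_cst.
rewrite derive1E.
have d : is_derive (0 : R) (1 : R) (fun b : R => expR (b ^+ 2 / 2) * b) 1.
  apply: is_derive_eq; rewrite /GRing.scale/=.
  by rewrite expr0n/= mul0r expR0; ring.
by rewrite (@derive_val _ _ _ _ _ _ _ d).
Qed.

Definition gauss_cos a := \int[gam]_x cos (a * x).

Lemma measurable_cosM a : measurable_fun [set: measurableTypeR R] (fun x : measurableTypeR R => cos (a * x)).
Proof.
apply: measurableT_comp; last exact: measurable_funM.
by apply: continuous_measurable_fun; exact: continuous_cos.
Qed.

Lemma measurable_sinM a : measurable_fun [set: measurableTypeR R] (fun x : measurableTypeR R => sin (a * x)).
Proof.
apply: measurableT_comp; last exact: measurable_funM.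
by apply: continuous_measurable_fun; exact: continuous_sin.
Qed.

Lemma norm_cos_le1 a : `|cos a| <= 1.
Proof. by rewrite ler_norml cos_geN1 cos_le1. Qed.

Lemma norm_sin_le1 a : `|sin a| <= 1.
Proof. by rewrite ler_norml sin_geN1 sin_le1. Qed.

Lemma gauss_integrable_cos a : gam.-integrable setT (fun x => (cos (a * x))%:E).
Proof.
apply: (@gauss_integrable _ (fun x => cos (a * x)) 1 0).
  exact: measurable_cosM.
by move=> x; rewrite mul0r expR0 mulr1 norm_cos_le1.
Qed.

Lemma gauss_integrable_sin a : gam.-integrable setT (fun x => (sin (a * x))%:E).
Proof.
apply: (@gauss_integrable _ (fun x => sin (a * x)) 1 0).
  exact: measurable_sinM.
by move=> x; rewrite mul0r expR0 mulr1 norm_sin_le1.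
Qed.

Lemma stein_sin a : \int[gam]_x (sin (a * x) * x) = a * gauss_cos a.
Proof.
rewrite (@stein (fun x => sin (a * x)) 1 0); last 2 first.
- exact: measurable_sinM.
- by move=> x; rewrite mul0r expR0 mulr1 norm_sin_le1.
rewrite (_ : (fun _ => _) =
    (fun b => expR (b ^+ 2 / 2) * (sin (a * b) * gauss_cos a))); last first.
  apply/funext => b; congr (_ * _).
  under eq_Rintegral do rewrite mulrDr sinD.
  rewrite RintegralD//; last 2 first.
  - by apply: integrable_mulrl; exact: gauss_integrable_cos.
  - by apply: integrable_mulrl; exact: gauss_integrable_sin.
  rewrite RintegralZl//; last exact: gauss_integrable_cos.
  rewrite RintegralZl//; last exact: gauss_integrable_sin.
  rewrite [X in _ + _ * X]Rintegral_gauss_odd ?mulr0 ?addr0//.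
  - exact: measurable_sinM.
  - by move=> x; rewrite mulrN sinN.
  - exact: gauss_integrable_sin.
rewrite derive1E.
have d : is_derive (0 : R) (1 : R)
    (fun b : R => expR (b ^+ 2 / 2) * (sin (a * b) * gauss_cos a)) (a * gauss_cos a).
  apply: is_derive_eq; rewrite /GRing.scale/=.
  by rewrite expr0n/= !(mulr0, mul0r) expR0 ?sin0 ?cos0; ring.
by rewrite (@derive_val _ _ _ _ _ _ _ d).
Qed.

(** By Stein's identity the cosine transform solves [y' = - a y], which
    determines it. *)
Lemma is_derive_gauss_cos a : is_derive a 1 gauss_cos (- a * gauss_cos a).
Proof.
pose f b x := cos (b * x) : R.
have df b x : is_derive b (1 : R) (f^~ x) (- (sin (b * x) * x)).
  rewrite /f; apply: is_derive_eq.
  by rewrite /GRing.scale/=; ring.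
have cond : [/\ `](a - 1), (a + 1)[%classic a,
   (forall b, `](a - 1), (a + 1)[%classic b -> gam.-integrable setT (EFin \o f b)),
   (forall b y, `](a - 1), (a + 1)[%classic b -> [set: R] y -> derivable (f ^~ y) b 1),
   gam.-integrable setT (EFin \o (fun x : R => `|x|)) &
   (forall b y, `](a - 1), (a + 1)[%classic b -> [set: R] y ->
      `|partial1of2 f b y| <= `|y|)].
  split.
  - by rewrite /= in_itv/= ltrBlDr ltrDl ltr01.
  - by move=> b _; exact: gauss_integrable_cos.
  - by move=> b y _ _; have [] := df b y.
  - apply: (@gauss_integrable _ _ 1 1); first exact: measurableT_comp.
    by move=> x; rewrite !mul1r normr_id le_expR.
  - move=> b x _ _; rewrite partial1of2E (@derive_val _ _ _ _ _ _ _ (df b x)) normrN normrM.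
    by rewrite ler_piMl// norm_sin_le1.
case: cond => c1 c2 c3 c4 c5.
apply: DeriveDef.
  exact: (@derivable_under_integral R _ _ gam f setT measurableT a (a - 1) (a + 1)
    c1 c2 c3 _ (@normr_ge0 _ _) c4 c5).
rewrite -derive1E (@differentiation_under_integral R _ _ gam f setT measurableT a (a - 1) (a + 1)
    c1 c2 c3 _ (@normr_ge0 _ _) c4 c5).
rewrite mulNr -stein_sin -mulN1r -RintegralZl//.
  by apply: eq_Rintegral => x _; rewrite partial1of2E (@derive_val _ _ _ _ _ _ _ (df a x)) mulN1r.
apply: (@gauss_integrable _ (fun x => sin (a * x) * x) 1 1).
  by apply: measurable_funM => //; exact: measurable_sinM.
by move=> x; rewrite !mul1r normrM (le_trans _ (le_expR _))// ler_piMl// norm_sin_le1.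
Qed.

Lemma gauss_cosE a : gauss_cos a = expR (- (a ^+ 2 / 2)).
Proof.
have d b : is_derive b (1 : R) (fun a => expR (a ^+ 2 / 2) * gauss_cos a) 0.
  have := is_derive_gauss_cos b => db.
  by apply: is_derive_eq; rewrite /GRing.scale/=; field.
have := is_derive_0_is_cst a 0 d.
rewrite expr0n/= mul0r expR0 mul1r {2}/gauss_cos.
rewrite (_ : \int[gam]_x _ = 1); last first.
  under eq_Rintegral do rewrite mul0r cos0.
  by rewrite Rintegral_prob_cst.
move=> h; apply: (@mulfI _ (expR (a ^+ 2 / 2))); first by rewrite gt_eqF ?expR_gt0.
by rewrite h -expRD subrr expR0.
Qed.

Lemma integral_gauss_expR_sqr t : - 1 < t ->
  (\int[gam]_x (expR (- (t * x ^+ 2 / 2)))%:E = ((Num.sqrt (1 + t))^-1)%:E)%E.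
Proof.
move=> t1; have t0 : 0 < 1 + t by rewrite -ltrBlDl sub0r.
pose s := (Num.sqrt (1 + t))^-1.
have s0 : 0 < s by rewrite invr_gt0 sqrtr_gt0.
have s2 : s ^+ 2 = (1 + t)^-1 by rewrite exprVn sqr_sqrtr// ltW.
have mf : measurable_fun [set: measurableTypeR R] (fun x : measurableTypeR R => expR (- (t * x ^+ 2 / 2))).
  apply: measurableT_comp => //; apply: measurableT_comp => //.
  apply: measurable_funM => //; apply: measurable_funM => //.
rewrite ge0_integral_gauss//; last first.
  exact/measurable_EFinP.
transitivity (\int[lebesgue_measure]_x (s%:E * (normal_pdf 0 s x)%:E))%E.
  apply: eq_integral => x _; rewrite -!EFinM; congr EFin.
  rewrite !normal_pdfE ?gt_eqF// [LHS]mulrCA [RHS]mulrA; congr (_ * _).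
    rewrite /normal_peak expr1n mul1r -!mulrnAr sqrtrM ?sqr_ge0// sqrtr_sqr.
    by rewrite gtr0_norm// invfM mulrA divff ?gt_eqF// mul1r.
  rewrite /normal_fun -expRD; congr expR; rewrite subr0 s2; field.
  by rewrite gt_eqF.
rewrite ge0_integralZl//.
- by rewrite integral_normal_pdf mule1.
- by apply/measurable_EFinP; exact: measurable_normal_pdf.
- by move=> x _; rewrite lee_fin normal_pdf_ge0.
- by rewrite lee_fin ltW.
Qed.

End stein.

(** * Bernstein polynomials and the moment problem on the unit interval *)

Section bounded_integrable.
Context d (T : measurableType d) (R : realType) (P : probability T R).

Lemma prob_integrable (f : T -> R) K : measurable_fun setT f ->
  (forall x, `|f x| <= K) -> P.-integrable setT (fun x => (f x)%:E).
Proof.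
move=> mf fK.
apply: (le_integrable measurableT (g := fun=> K%:E)).
- exact/measurable_EFinP.
- by move=> x _; rewrite /= lee_fin (le_trans (fK x))// ler_norm.
- exact: finite_measure_integrable_cst.
Qed.

Lemma le_Rintegral_prob (f g : T -> R) K : measurable_fun setT f ->
  measurable_fun setT g ->
  (forall x, `|f x| <= K) -> (forall x, `|g x| <= K) ->
  (forall x, f x <= g x) -> \int[P]_x f x <= \int[P]_x g x.
Proof.
by move=> mf mg fK gK fg; apply: le_Rintegral => //; exact: prob_integrable.
Qed.

End bounded_integrable.

Section prob_interval.
Context d (T : measurableType d) (R : realType) (P : probability T R).

Lemma prob_intervalE (U : T -> R) a b : measurable_fun setT U ->
  P [set w | a < U w < b] = (\int[P]_w (\1_(`]a, b[%classic) (U w) : R)%:E)%E.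
Proof.
move=> mU.
have mI : measurable [set w | a < U w < b].
  rewrite -[X in measurable X]setTI (_ : [set w | _] = U @^-1` `]a, b[%classic).
    exact: mU.
  by apply/seteqP; split => w /=; rewrite in_itv.
transitivity (\int[P]_w (\1_[set w | (a < U w < b)%R] w)%:E)%E.
  by rewrite integral_indic// setIT.
  apply: eq_integral => w _.
  rewrite !indicE (_ : (w \in _) = (U w \in `]a, b[%classic))//.
Qed.

End prob_interval.

Section bernstein.
Variable R : realType.
Implicit Types (phi psi : nat -> R) (x : R).

(** Expectation of [phi K] for a binomial [K] with [n] trials of success
    probability [x], in the recursive form that makes its moments and its
    polynomial dependence on [x] immediate. *)
Fixpoint bernstein n phi x : R :=
  if n is m.+1 then
    x * bernstein m (fun k => phi k.+1) x + (1 - x) * bernstein m phi x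
  else phi 0%N.

Lemma le_bernstein n phi psi x : 0 <= x <= 1 ->
  (forall k, phi k <= psi k) -> bernstein n phi x <= bernstein n psi x.
Proof.
move=> /andP[x0 x1]; elim: n phi psi => [|n IH] phi psi le_phi_psi /=; first exact: le_phi_psi.
by rewrite lerD// ler_wpM2l ?subr_ge0// IH.
Qed.

Lemma bernsteinB n phi psi x :
  bernstein n (fun k => phi k - psi k) x = bernstein n phi x - bernstein n psi x.
Proof. by elim: n phi psi => //= n IH phi psi; rewrite !IH; ring. Qed.

Lemma bernstein_cst n c x : bernstein n (fun=> c) x = c.
Proof. by elim: n => //= n ->; ring. Qed.

Lemma bernstein_sqr n (a b c : R) x :
  bernstein n (fun k => a + b * (k%:R + c) ^+ 2) x =
  a + b * ((n%:R * x + c) ^+ 2 + n%:R * x * (1 - x)).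
Proof.
elim: n c => [|n IH] c /=; first by ring.
have -> : (fun k => a + b * (k.+1%:R + c) ^+ 2) =
          (fun k => a + b * (k%:R + (1 + c)) ^+ 2).
  by apply/funext => k; rewrite -addn1 natrD; ring.
by rewrite !IH -[in RHS]addn1 natrD; ring.
Qed.

(** With [K] binomial, [|x - K / N|] is at most [e] plus [(x - K / N) ^ 2 / e],
    and the mean of the square is the variance [x (1 - x) / N]. *)
Lemma bernstein_lipschitz (f : R -> R) L (e : R) n x : 0 <= L -> 0 < e ->
  (forall y z, `|f y - f z| <= L * `|y - z|) -> 0 <= x <= 1 ->
  `|f x - bernstein n.+1 (fun k => f (k%:R / n.+1%:R)) x|
  <= L * (e + (e * n.+1%:R)^-1).
Proof.
move=> L0 e0 fL x01; set N := n.+1%:R : R.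
have N0 : 0 < N by rewrite ltr0n.
have step k : `|f x - f (k%:R / N)| <=
    L * e + L / (e * N ^+ 2) * (k%:R + - (N * x)) ^+ 2.
  rewrite (le_trans (fL _ _))// -mulrA -mulrDr ler_wpM2l//.
  have -> : (e * N ^+ 2)^-1 * (k%:R + - (N * x)) ^+ 2 = (x - k%:R / N) ^+ 2 / e.
    by field; rewrite !gt_eqF.
  rewrite -[X in _ <= _ + X / _]real_normK ?num_real//; set y := `|_|.
  have y0 : 0 <= y by exact: normr_ge0.
  rewrite -(ler_pM2r e0) mulrDl divfK ?gt_eqF//; nra.
have bound : bernstein n.+1
    (fun k => L * e + L / (e * N ^+ 2) * (k%:R + - (N * x)) ^+ 2) x
    <= L * (e + (e * N)^-1).
  rewrite bernstein_sqr [leRHS]mulrDr lerD2l subrr expr0n/= add0r -/N.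
  have -> : L / (e * N ^+ 2) * (N * x * (1 - x)) = L * (e * N)^-1 * (x * (1 - x)).
    by field; rewrite !gt_eqF.
  have C0 : 0 <= L * (e * N)^-1 by rewrite mulr_ge0// invr_ge0 ltW// mulr_gt0.
  rewrite (ler_piMr C0)//.
  by move: x01 => /andP[x0 x1]; rewrite mulr_ile1 ?subr_ge0//; lra.
rewrite -[X in X - _](bernstein_cst n.+1 _ x) -bernsteinB ler_norml; apply/andP; split.
  rewrite lerNl; apply: le_trans bound.
  have -> : - bernstein n.+1 (fun k => f x - f (k%:R / N)) x =
            bernstein n.+1 (fun k => 0 - (f x - f (k%:R / N))) x.
    by rewrite [RHS]bernsteinB bernstein_cst sub0r.
  apply: le_bernstein => // k; rewrite sub0r; apply: le_trans (step k).
  by rewrite -normrN ler_norm.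
apply: le_trans bound; apply: le_bernstein => // k.
by apply: le_trans (step k); rewrite ler_norm.
Qed.

End bernstein.

Section moments.
Variable R : realType.
Context d1 (T1 : measurableType d1) d2 (T2 : measurableType d2).
Variables (P1 : probability T1 R) (P2 : probability T2 R).
Variables (U1 : T1 -> R) (U2 : T2 -> R).
Hypotheses (mU1 : measurable_fun setT U1) (mU2 : measurable_fun setT U2).
Hypotheses (U101 : forall w, 0 <= U1 w <= 1) (U201 : forall w, 0 <= U2 w <= 1).
Hypothesis moments : forall k : nat,
  \int[P1]_w (U1 w ^+ k) = \int[P2]_w (U2 w ^+ k).

Lemma measurable_bernstein d (T : measurableType d) (U : T -> R) n phi :
  measurable_fun setT U -> measurable_fun setT (fun w => bernstein n phi (U w)).
Proof.
move=> mU; elim: n phi => [|n IH] phi /=; first exact: measurable_cst.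
by apply: measurable_funD; apply: measurable_funM => //; exact: measurable_funB.
Qed.

Lemma bernstein_bounded n (phi : nat -> R) : exists K, forall x,
  0 <= x <= 1 -> `|bernstein n phi x| <= K.
Proof.
elim: n phi => [|n IH] phi; first by exists `|phi 0%N|.
have [K1 hK1] := IH (fun k => phi k.+1); have [K2 hK2] := IH phi.
exists (K1 + K2) => x x01 /=; rewrite (le_trans (ler_normD _ _))// !normrM.
move: (x01) => /andP[x0 x1].
rewrite lerD//.
  by rewrite -[leRHS]mul1r ler_pM// ?hK1// ger0_norm.
by rewrite -[leRHS]mul1r ler_pM// ?hK2// ger0_norm; lra.
Qed.

Lemma moment_bernstein_integrable d (T : measurableType d) (P : probability T R)
    (U : T -> R) n phi j : measurable_fun setT U ->
  (forall w, 0 <= U w <= 1) ->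
  P.-integrable setT (fun w => (U w ^+ j * bernstein n phi (U w))%:E).
Proof.
move=> mU U01; have [K hK] := bernstein_bounded n phi.
apply: (@prob_integrable _ _ _ P _ K).
  apply: measurable_funM; first exact: measurable_funX.
  exact: measurable_bernstein.
move=> w; rewrite normrM -[leRHS]mul1r ler_pM ?hK//.
have /andP[u0 u1] := U01 w.
by rewrite ger0_norm ?exprn_ge0// exprn_ile1.
Qed.

(** The power [j] makes the induction go through: the recursive definition of
    the Bernstein polynomials multiplies by [U] and by [1 - U]. *)
Lemma eq_moment_bernstein n phi j :
  \int[P1]_w (U1 w ^+ j * bernstein n phi (U1 w)) =
  \int[P2]_w (U2 w ^+ j * bernstein n phi (U2 w)).
Proof.
elim: n phi j => [|n IH] phi j /=.
  rewrite !RintegralZr ?moments//.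
    by have := @moment_bernstein_integrable _ _ P2 U2 0%N (fun=> 1) j mU2 U201;
      under eq_fun do rewrite mulr1.
  by have := @moment_bernstein_integrable _ _ P1 U1 0%N (fun=> 1) j mU1 U101;
    under eq_fun do rewrite mulr1.
have E d (T : measurableType d) (P : probability T R) (U : T -> R) :
    measurable_fun setT U -> (forall w, 0 <= U w <= 1) ->
    \int[P]_w (U w ^+ j *
      (U w * bernstein n (fun k => phi k.+1) (U w) + (1 - U w) * bernstein n phi (U w)))
    = \int[P]_w (U w ^+ j.+1 * bernstein n (fun k => phi k.+1) (U w))
    + (\int[P]_w (U w ^+ j * bernstein n phi (U w))
       - \int[P]_w (U w ^+ j.+1 * bernstein n phi (U w))).
  move=> mU U01; rewrite -RintegralB//; try exact: moment_bernstein_integrable.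
  rewrite -RintegralD//; try exact: moment_bernstein_integrable.
    by apply: eq_Rintegral => w _; rewrite exprS; ring.
  rewrite (_ : _ \o _ = fun w => ((U w ^+ j * bernstein n phi (U w))%:E
     - (U w ^+ j.+1 * bernstein n phi (U w))%:E)%E)//.
  by apply: integrableB => //; exact: moment_bernstein_integrable.
by rewrite !E// !IH.
Qed.

Lemma eq_expectation_lipschitz (f : R -> R) L : 0 <= L ->
  (forall y z, `|f y - f z| <= L * `|y - z|) -> measurable_fun setT f ->
  \int[P1]_w f (U1 w) = \int[P2]_w f (U2 w).
Proof.
move=> L0 fL mf.
have near d (T : measurableType d) (P : probability T R) (U : T -> R) (e : R) n :
    0 < e ->
    measurable_fun setT U -> (forall w, 0 <= U w <= 1) ->
    `|\int[P]_w f (U w)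
      - \int[P]_w bernstein n.+1 (fun k => f (k%:R / n.+1%:R)) (U w)|
    <= L * (e + (e * n.+1%:R)^-1).
  move=> e0 mU U01; set phi := fun k : nat => f (k%:R / n.+1%:R); set C := L * _.
  have fi : P.-integrable setT (EFin \o (fun w => f (U w))).
    apply: (@prob_integrable _ _ _ P _ (`|f 0| + L)).
      exact: measurableT_comp.
    move=> w; have /andP[u0 u1] := U01 w.
    rewrite -[X in `|X|](subrK (f 0)) (le_trans (ler_normD _ _))// addrC lerD2l.
    by rewrite (le_trans (fL _ _))// subr0 ger0_norm// ler_piMr.
  have bi : P.-integrable setT (EFin \o (fun w => bernstein n.+1 phi (U w))).
    have := @moment_bernstein_integrable _ _ P U n.+1 phi 0%N mU U01.
    by under eq_fun do rewrite mul1r.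
  rewrite -RintegralB//.
  have h : \int[P]_w `|f (U w) - bernstein n.+1 phi (U w)| <= C.
    rewrite -[leRHS](Rintegral_prob_cst P); apply: le_Rintegral => //.
    - have := integrable_norm (integrableB measurableT fi bi).
      by apply: eq_integrable => // w _ /=.
    - exact: finite_measure_integrable_cst.
    - by move=> w _; exact: bernstein_lipschitz.
  apply: le_trans h; apply: le_normr_Rintegral => //.
  rewrite (_ : _ \o _ = fun w => ((f (U w))%:E
     - (bernstein n.+1 phi (U w))%:E)%E)//.
  exact: (integrableB measurableT fi bi).
apply/eqP; rewrite -subr_eq0 -normr_le0; apply/ler_addgt0Pl => e e0; rewrite addr0.
pose t := e / (4 * (L + 1)).
have L1 : 0 < L + 1 by rewrite ltr_wpDl.
have t0 : 0 < t by rewrite divr_gt0// mulr_gt0.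
pose n := Num.truncn (t ^- 2).
have nt : (t * n.+1%:R)^-1 <= t.
  have tN : 0 < t * n.+1%:R by apply: mulr_gt0; rewrite ?ltr0n.
  rewrite -[leLHS]mul1r (ler_pdivrMr _ _ tN) mulrA -expr2.
  rewrite -ler_pdivrMl ?exprn_gt0// mulr1 ltW//.
  by rewrite /n; exact: truncnS_gt.
have := near _ _ P1 U1 t n t0 mU1 U101; have := near _ _ P2 U2 t n t0 mU2 U201.
have -> : \int[P1]_w bernstein n.+1 (fun k => f (k%:R / n.+1%:R)) (U1 w) =
          \int[P2]_w bernstein n.+1 (fun k => f (k%:R / n.+1%:R)) (U2 w).
  have := eq_moment_bernstein n.+1 (fun k => f (k%:R / n.+1%:R)) 0.
  by under eq_Rintegral do rewrite mul1r; under [in RHS]eq_Rintegral do rewrite mul1r.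
set A := \int[P1]_w f (U1 w); set B := \int[P2]_w f (U2 w); set D := \int[P2]_w _.
move=> h2 h1.
have hC : L * (t + (t * n.+1%:R)^-1) <= e / 2.
  apply: (@le_trans _ _ (L * (t + t))); first by rewrite ler_wpM2l// lerD2l.
  rewrite /t (_ : L * _ = (L / (L + 1)) * (e / 2)); last by field; rewrite gt_eqF.
  by rewrite ler_piMl ?divr_ge0 ?ltW// ltr_pdivrMr// mul1r ltrDl.
have -> : A - B = (A - D) - (B - D) by ring.
by rewrite (le_trans (ler_normB _ _))// (le_trans (lerD h1 h2))// (le_trans (lerD hC hC))// -splitr.
Qed.

(** Continuous functions that increase with [k] to the indicator of the open
    interval, with Lipschitz constant [k]. *)
Definition tent (a b : R) (k : nat) (u : R) : R :=
  Num.min 1 (k%:R * Num.max 0 (Num.min (u - a) (b - u))).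

Lemma tent_lipschitz a b k y z : `|tent a b k y - tent a b k z| <= k%:R * `|y - z|.
Proof.
have nm (s t : R) : s - t <= `|s - t| /\ t - s <= `|s - t|.
  by split; [exact: ler_norm|rewrite distrC; exact: ler_norm].
have h (s t : R) : `|Num.max 0 s - Num.max 0 t| <= `|s - t|.
  have [n1 n2] := nm s t.
  by case: (leP 0 s) => hs; case: (leP 0 t) => ht;
    rewrite ler_norml; apply/andP; split; lra.
have h1 (s t : R) : `|Num.min 1 s - Num.min 1 t| <= `|s - t|.
  have [n1 n2] := nm s t.
  by case: (leP 1 s) => hs; case: (leP 1 t) => ht;
    rewrite ler_norml; apply/andP; split; lra.
rewrite (le_trans (h1 _ _))// -mulrBr normrM ger0_norm// ler_wpM2l//.
rewrite (le_trans (h _ _))//; have [n1 n2] := nm y z.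
by case: (leP (y - a) (b - y)) => h3; case: (leP (z - a) (b - z)) => h4;
  rewrite ler_norml; apply/andP; split; lra.
Qed.

Lemma measurable_tent a b k : measurable_fun [set: R] (tent a b k).
Proof.
apply: measurable_minr => //; apply: measurable_funM => //.
apply: measurable_maxr => //; apply: measurable_minr; exact: measurable_funB.
Qed.

Lemma tent_ge0 a b k u : 0 <= tent a b k u.
Proof. by rewrite le_min ler01/= mulr_ge0// le_max lexx. Qed.

Lemma tent_le1 a b k u : tent a b k u <= 1.
Proof. by rewrite ge_min lexx. Qed.

Lemma tent_cvg a b u : tent a b k u @[k --> \oo] --> (\1_(`]a, b[%classic) u : R).
Proof.
rewrite indicE; have [uab|/negP uab] := boolP (u \in `]a, b[%classic).
  move: uab; rewrite inE/= in_itv/= => /andP[au ub].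
  pose m := Num.min (u - a) (b - u).
  have m0 : 0 < m by rewrite lt_min !subr_gt0 au.
  apply: cvg_near_cst; near=> k.
  rewrite /tent -/m (max_idPr (ltW m0)); apply/min_idPl.
  rewrite -ler_pdivrMr// (le_trans (ltW (truncnS_gt _)))// ler_nat.
  by near: k; exact: nbhs_infty_ge.
rewrite (_ : (fun k => _) = cst 0); first exact: cvg_cst.
have m0 : Num.min (u - a) (b - u) <= 0.
  rewrite ge_min !subr_le0; apply/negPn/negP; rewrite negb_or -!ltNge => uab'.
  by apply: uab; rewrite inE/= in_itv.
apply/funext => k; rewrite /tent (max_idPl m0) mulr0.
by apply/min_idPr; exact: ler01.
Unshelve. all: by end_near. Qed.

Lemma prob_interval_tent d (T : measurableType d) (P : probability T R) (U : T -> R)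
    a b : measurable_fun setT U ->
  (\int[P]_w (tent a b k (U w))%:E)%E @[k --> \oo] -->
  P [set w | a < U w < b].
Proof.
move=> mU.
rewrite prob_intervalE//.
have mt k : measurable_fun setT (fun w => (tent a b k (U w))%:E).
  by apply/measurable_EFinP; apply: measurableT_comp => //; exact: measurable_tent.
have [] := @dominated_convergence _ T _ P setT measurableT
  (fun k w => (tent a b k (U w))%:E) (fun w => (\1_(`]a, b[%classic) (U w))%:E)
  (fun=> 1%E) mt.
- apply/measurable_EFinP.
  have mi : measurable_fun [set: R] (\1_(`]a, b[%classic) : R -> R).
    by apply: measurable_indic; exact: measurable_itv.
  exact: (measurableT_comp mi mU).
- apply/aeW => w _; apply: cvg_EFin; first exact: nearW.
  exact: tent_cvg.
- exact: finite_measure_integrable_cst.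
- by apply/aeW => w k _; rewrite /= lee_fin ger0_norm ?tent_ge0// tent_le1.
by [].
Qed.

(** Bernstein polynomials approximate Lipschitz functions uniformly on the unit
    interval, so the moments determine the mean of each [tent], and in the limit
    the law. *)
Lemma moments_eq_interval a b :
  P1 [set w | a < U1 w < b] = P2 [set w | a < U2 w < b].
Proof.
have := @prob_interval_tent _ _ P2 _ a b mU2.
have := @prob_interval_tent _ _ P1 _ a b mU1.
have tb d (T : measurableType d) (P : probability T R) (U : T -> R) k :
    measurable_fun setT U ->
    P.-integrable setT (fun w => (tent a b k (U w))%:E).
  move=> mU; apply: (@prob_integrable _ _ _ P _ 1).
    by apply: measurableT_comp => //; exact: measurable_tent.
  by move=> w; rewrite ger0_norm ?tent_ge0// tent_le1.
rewrite (_ : (fun k => _) = (fun k => \int[P2]_w (tent a b k (U2 w))%:E)%E).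
  by move=> /cvg_lim <-// /cvg_lim <-.
apply/funext => k; rewrite -[LHS]fineK ?integrable_fin_num ?tb//.
rewrite -[RHS]fineK ?integrable_fin_num ?tb//; congr EFin.
apply: (@eq_expectation_lipschitz _ k%:R) => //.
- exact: tent_lipschitz.
- exact: measurable_tent.
Qed.

End moments.

(** * Gaussian measure of planar annuli *)

Section planar.
Variable R : realType.
Local Notation mu := (@lebesgue_measure R).
Local Notation gam := (gauss R).
Local Notation R2 := (measurableTypeR R * measurableTypeR R)%type.
Implicit Types (a b s r : R).

Local Notation I a b := (\1_(`]a, b[%classic) : R -> R).

Lemma mem_oo (c d t : R) : (t \in `]c, d[%classic) = (c < t < d).
Proof. by apply/idP/idP; rewrite inE/= in_itv. Qed.

Lemma measurable_indic_oo (c d : R) :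
  measurable_fun [set: R] (\1_(`]c, d[%classic) : R -> R).
Proof. by apply: measurable_indic; exact: measurable_itv. Qed.

Lemma measurable_planar (c0 c1 a b : R) : measurable_fun [set: R2]
  (fun p : R2 => (I a b (c0 * p.1 ^+ 2 + c1 * p.2 ^+ 2))%:E).
Proof.
apply/measurable_EFinP.
apply: (measurableT_comp (measurable_indic_oo a b)); apply: measurable_funD => /=;
  by apply: measurable_funM => //; apply: measurable_funX.
Qed.

(** The area of the annulus with squared radii between [a] and [b]. The
    coefficients one make it an instance of the elliptical case. *)
Definition area a b : \bar R :=
  (\int[mu]_y \int[mu]_z (I a b (1 * y ^+ 2 + 1 * z ^+ 2))%:E)%E.

Lemma measurable_planar_slice (c0 c1 a b y : R) :
  measurable_fun [set: measurableTypeR R]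
    (fun z : measurableTypeR R => (I a b (c0 * y ^+ 2 + c1 * z ^+ 2))%:E).
Proof. exact: (measurableT_comp (measurable_planar c0 c1 a b) (pair1_measurable y)). Qed.

Lemma measurable_area_slice a b : measurable_fun [set: measurableTypeR R]
  (fun y => \int[mu]_z (I a b (1 * y ^+ 2 + 1 * z ^+ 2))%:E)%E.
Proof.
apply: (@measurable_fun_fubini_tonelli_F _ _ _ _ _ mu
  (fun p : R2 => (I a b (1 * p.1 ^+ 2 + 1 * p.2 ^+ 2))%:E)).
- exact: measurable_planar.
- by move=> x.
Qed.

Lemma area_ge0 a b : (0 <= area a b)%E.
Proof. by apply: integral_ge0 => y _; apply: integral_ge0. Qed.

Lemma area_scale r a b : 0 < r -> area (r * a) (r * b) = (r%:E * area a b)%E.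
Proof.
move=> r0; pose s := Num.sqrt r.
have s0 : 0 < s by rewrite sqrtr_gt0.
have s1 : s != 0 by rewrite gt_eqF.
have ss : r = s * s by rewrite -expr2 sqr_sqrtr// ltW.
rewrite /area (ge0_integral_affine 0 s1 (measurable_area_slice (r * a) (r * b))); last first.
  by move=> x; apply: integral_ge0.
rewrite ss EFinM -muleA gtr0_norm//; congr (_ * _)%E.
rewrite -ge0_integralZl//; last 3 first.
- exact: measurable_area_slice.
- by move=> x _; apply: integral_ge0.
- by rewrite lee_fin ltW.
apply: eq_integral => y _.
rewrite (ge0_integral_affine 0 s1 (measurable_planar_slice 1 1 _ _ _))//.
rewrite gtr0_norm//; congr (_ * _)%E; apply: eq_integral => z _; congr EFin.
rewrite !indicE (_ : (_ \in _) = (1 * y ^+ 2 + 1 * z ^+ 2 \in `]a, b[%classic))//.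
have -> : 1 * (0 + s * y) ^+ 2 + 1 * (0 + s * z) ^+ 2 =
   s * s * (1 * y ^+ 2 + 1 * z ^+ 2) by ring.
by rewrite !mem_oo !(ltr_pM2l (mulr_gt0 s0 s0)).
Qed.

(** The disc lies in a square of side two. *)
Lemma area_disc_le4 : (area (- 1) 1 <= 4%:E)%E.
Proof.
pose J : set (measurableTypeR R) := `](- 1), 1[%classic.
pose iJ : measurableTypeR R -> R := \1_J.
have mJ : measurable J by exact: measurable_itv.
have muJ : mu J = 2%:E.
  rewrite /J lebesgue_measure_itv/= lte_fin gtrN ?ltr01//.
  by rewrite -EFinD; congr EFin; ring.
have mJe : measurable_fun [set: measurableTypeR R] (fun x => (iJ x)%:E).
  by apply/measurable_EFinP; exact: measurable_indic.
apply: (@le_trans _ _ (\int[mu]_y \int[mu]_z ((iJ y)%:E * (iJ z)%:E))%E).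
  apply: ge0_le_integral => //.
  - by move=> y _; apply: integral_ge0.
  - exact: measurable_area_slice.
  - apply: (@measurable_fun_fubini_tonelli_F _ _ _ _ _ mu
      (fun p : R2 => (iJ p.1)%:E * (iJ p.2)%:E)%E) => [|x].
      by apply: emeasurable_funM; apply: (measurableT_comp mJe).
    by rewrite mule_ge0// lee_fin.
  - move=> y _; apply: ge0_le_integral => //.
    + exact: measurable_planar_slice.
    + by apply: emeasurable_funM => //; exact: measurable_cst.
    + move=> z _; rewrite -EFinM lee_fin /iJ !indicE.
      have [h|//] := boolP (_ + _ \in `](-1), 1[%classic); last first.
        by rewrite mulr_ge0.
      move: h; rewrite mem_oo => /andP[_ h].
      have aux (x t : R) : 1 * x ^+ 2 + 1 * t ^+ 2 < 1 -> x \in J.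
        move=> xt; rewrite /J mem_oo; apply/andP.
        have := sqr_ge0 t; split; nra.
      by rewrite (aux y z h) (aux z y) ?mulr1// addrC.
have intJ : (\int[mu]_y (iJ y)%:E = 2%:E)%E by rewrite integral_indic// setIT.
have iJ0 y : (0 <= (iJ y)%:E)%E by rewrite lee_fin.
have inner y : (\int[mu]_z ((iJ y)%:E * (iJ z)%:E) = (iJ y)%:E * 2%:E)%E.
  by rewrite ge0_integralZl// intJ.
under eq_integral do rewrite inner.
rewrite ge0_integralZr// intJ.
by rewrite -EFinM lee_fin; lra.
Qed.

Lemma le_area a b a' b' : a' <= a -> b <= b' -> (area a b <= area a' b')%E.
Proof.
move=> aa bb; apply: ge0_le_integral => //.
- by move=> y _; apply: integral_ge0.
- exact: measurable_area_slice.
- exact: measurable_area_slice.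
move=> y _; apply: ge0_le_integral => //.
- exact: measurable_planar_slice.
- exact: measurable_planar_slice.
move=> z _; rewrite lee_fin !indicE ler_nat.
case: (boolP (_ \in `]a, b[%classic)) => // h.
move: h; rewrite !mem_oo => /andP[h1 h2].
by rewrite (le_lt_trans aa h1) (lt_le_trans h2 bb).
Qed.

(** Squared radii are nonnegative, so every negative lower end describes the
    same disc; scaling does the rest. *)
Lemma area_disc b : 0 <= b -> area (- 1) b = (b%:E * area (- 1) 1)%E.
Proof.
rewrite le_eqVlt => /predU1P[<-|b0].
  rewrite mul0e /area; under eq_integral => y _.
    under eq_integral => z _.
      rewrite indicE (_ : (_ \in _) = false); last first.
        rewrite mem_oo; apply/negbTE; rewrite negb_and -!leNgt; apply/orP; right.
        by rewrite addr_ge0// mul1r sqr_ge0.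
      over.
    by rewrite integral0 over.
  by rewrite integral0.
rewrite -(area_scale (- 1) 1 b0) mulr1.
have E c : c < 0 -> area c b = area (- 1) b.
  move=> c0; apply: eq_integral => y _; apply: eq_integral => z _; congr EFin.
  rewrite !indicE (_ : (_ \in _) = (1 * y ^+ 2 + 1 * z ^+ 2 \in `](-1), b[%classic))//.
  have h : 0 <= 1 * y ^+ 2 + 1 * z ^+ 2 by rewrite !mul1r addr_ge0// sqr_ge0.
  rewrite !mem_oo; apply/idP/idP => /andP[_ ->]; rewrite andbT.
    by rewrite (lt_le_trans _ h)// ltrN10.
  exact: lt_le_trans h.
by rewrite (E (b * - 1)) // mulrN1 oppr_lt0.
Qed.

(** The area of an annulus is the difference of those of two discs. *)
Lemma area_le a b : a < b -> (area a b <= (4 * (b - a))%:E)%E.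
Proof.
move=> ab; have [b0|b0] := leP b 0.
  apply: (@le_trans _ _ (area a 0)); first exact: le_area.
  apply: (@le_trans _ _ 0%E); last by rewrite lee_fin mulr_ge0// subr_ge0 ltW.
  rewrite /area; under eq_integral => y _.
    under eq_integral => z _.
      rewrite indicE (_ : (_ \in _) = false); last first.
        rewrite mem_oo; apply/negbTE; rewrite negb_and -!leNgt; apply/orP; right.
        by rewrite addr_ge0// mul1r sqr_ge0.
      over.
    by rewrite integral0 over.
  by rewrite integral0.
have [c c0 areac] : exists2 c : R, 0 <= c <= 4 & area (- 1) 1 = c%:E.
  move: area_disc_le4 (area_ge0 (- 1) 1); case: (area (-1) 1) => [c| |]//.
  by rewrite !lee_fin => c4 c0; exists c; rewrite ?c0.
have [a0|a0] := ltP a 0.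
  apply: (@le_trans _ _ (area (Num.min a (- 1)) b)).
    by apply: le_area => //; rewrite ge_min lexx.
  have -> : area (Num.min a (- 1)) b = area (- 1) b.
    apply: eq_integral => y _; apply: eq_integral => z _; congr EFin.
    rewrite !indicE (_ : (_ \in _) = (1 * y ^+ 2 + 1 * z ^+ 2 \in `](-1), b[%classic))//.
    have h : 0 <= 1 * y ^+ 2 + 1 * z ^+ 2 by rewrite !mul1r addr_ge0// sqr_ge0.
    rewrite !mem_oo; apply/idP/idP => /andP[_ ->]; rewrite andbT.
      by rewrite (lt_le_trans _ h)// ltrN10.
    by rewrite (lt_le_trans _ h)// gt_min a0.
  rewrite (area_disc (ltW b0)) areac -EFinM lee_fin.
  by move: c0 => /andP[]; nra.
have sum_le : (area a b + area (- 1) a <= area (- 1) b)%E.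
  rewrite /area -ge0_integralD//; last 4 first.
  - by move=> y _; apply: integral_ge0.
  - exact: measurable_area_slice.
  - by move=> y _; apply: integral_ge0.
  - exact: measurable_area_slice.
  apply: ge0_le_integral => //.
  - by move=> y _; rewrite adde_ge0//; apply: integral_ge0.
  - by apply: emeasurable_funD; exact: measurable_area_slice.
  - exact: measurable_area_slice.
  move=> y _; rewrite -ge0_integralD//; last 2 first.
  - exact: measurable_planar_slice.
  - exact: measurable_planar_slice.
  apply: ge0_le_integral => //.
  - by move=> z _; rewrite adde_ge0.
  - by apply: emeasurable_funD; exact: measurable_planar_slice.
  - exact: measurable_planar_slice.
  move=> z _; rewrite -EFinD lee_fin !indicE -natrD ler_nat.
  set t := 1 * y ^+ 2 + _.
  rewrite !mem_oo; case: (ltgtP a t) => h1; rewrite /= ?andbF ?andbT//.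
  + by case: (t < b) => //=; rewrite (lt_trans _ h1)// (lt_le_trans _ a0)// ltrN10.
  + by rewrite (lt_trans h1 ab); case: (-1 < t).
rewrite (area_disc (ltW b0)) (area_disc a0) areac in sum_le.
rewrite -!EFinM in sum_le.
move: sum_le; move: (area_ge0 a b); case: (area a b) => [v| |]//.
rewrite -EFinD !lee_fin => v0 sum_le; move: c0 => /andP[]; nra.
Qed.

End planar.

Section gauss_annulus.
Variable R : realType.
Local Notation mu := (@lebesgue_measure R).
Local Notation gam := (gauss R).
Local Notation R2 := (measurableTypeR R * measurableTypeR R)%type.
Local Notation I a b := (\1_(`]a, b[%classic) : R -> R).

Lemma ge0_integral_gauss_scale s (f : measurableTypeR R -> \bar R) : s != 0 ->
  measurable_fun setT f -> (forall x, 0 <= f x)%E ->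
  (\int[gam]_x f (s * x)%R = \int[mu]_x (f x * (normal_pdf 0 s x)%:E))%E.
Proof.
move=> s0 mf f0; rewrite -(ge0_integral_normal_prob 0 s mf f0).
rewrite (ge0_integral_normal_affine 0 s0 mf f0).
by apply: eq_integral => x _; rewrite add0r.
Qed.

(** Since [l1 <= l0], the exponent of the density is at most
    [- (y ^ 2 + z ^ 2) / (2 l0)] in the coordinates of variances [l0] and [l1];
    integrate this over the annulus and use [4 / (2 pi) <= 1]. *)
Lemma gauss_annulus (l0 l1 a b : R) : 0 < l1 -> l1 <= l0 -> a < b ->
  (\int[gam]_y \int[gam]_z (I a b (l0 * y ^+ 2 + l1 * z ^+ 2))%:E <=
   ((b - a) / Num.sqrt (l0 * l1) * expR (- (Num.max a 0 / (2 * l0))))%:E)%E.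
Proof.
move=> l10 l1l0 ab.
have l00 : 0 < l0 by exact: lt_le_trans l1l0.
pose s0 := Num.sqrt l0; pose s1 := Num.sqrt l1.
have s00 : 0 < s0 by rewrite sqrtr_gt0.
have s10 : 0 < s1 by rewrite sqrtr_gt0.
have s02 : s0 ^+ 2 = l0 by rewrite sqr_sqrtr// ltW.
have s12 : s1 ^+ 2 = l1 by rewrite sqr_sqrtr// ltW.
have mpdf s : measurable_fun [set: measurableTypeR R]
    (fun x => (normal_pdf 0 s x)%:E).
  by apply/measurable_EFinP; exact: measurable_normal_pdf.
have pdf0 s x : (0 <= (normal_pdf 0 s x)%:E :> \bar R)%E.
  by rewrite lee_fin normal_pdf_ge0.
have I0 c d x : (0 <= (I c d x)%:E)%E by rewrite lee_fin.
pose F (p : R2) := ((I a b (1 * p.1 ^+ 2 + 1 * p.2 ^+ 2))%:E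
                    * (normal_pdf 0 s1 p.2)%:E)%E.
have mF : measurable_fun [set: R2] F.
  apply: emeasurable_funM; first exact: measurable_planar.
  exact: (measurableT_comp (mpdf s1)).
have F0 p : (0 <= F p)%E by rewrite mule_ge0.
pose G y := (\int[mu]_z F (y, z))%E.
have mG : measurable_fun [set: measurableTypeR R] G.
  by apply: measurable_fun_fubini_tonelli_F.
have G0 y : (0 <= G y)%E by apply: integral_ge0 => z _; exact: F0.
have -> : (\int[gam]_y \int[gam]_z (I a b (l0 * y ^+ 2 + l1 * z ^+ 2))%:E
    = \int[mu]_y (G y * (normal_pdf 0 s0 y)%:E))%E.
  rewrite -(ge0_integral_gauss_scale (lt0r_neq0 s00) mG G0).
  apply: eq_integral => y _.
  rewrite /G /F/= -(ge0_integral_gauss_scale (f := fun z =>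
    (I a b (1 * (s0 * y) ^+ 2 + 1 * z ^+ 2))%:E) (lt0r_neq0 s10)).
  - apply: eq_integral => z _; congr (I a b _)%:E.
    by rewrite -s02 -s12; ring.
  - exact: measurable_planar_slice.
  - by move=> z.
set E := expR _.
pose K := normal_peak s0 * normal_peak s1 * E.
have K0 : 0 <= K by rewrite !mulr_ge0 ?normal_peak_ge0 ?expR_ge0.
have pdf_le y z : I a b (1 * y ^+ 2 + 1 * z ^+ 2)
    * normal_pdf 0 s1 z * normal_pdf 0 s0 y
    <= K * I a b (1 * y ^+ 2 + 1 * z ^+ 2).
  rewrite indicE mem_oo; case: (boolP (a < _ < b)) => [/andP[h _]|_]; last first.
    by rewrite !mul0r mulr0.
  rewrite mul1r mulr1 !normal_pdfE ?gt_eqF// mulrC mulrACA.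
  rewrite ler_wpM2l ?mulr_ge0 ?normal_peak_ge0// /normal_fun -expRD ler_expR.
  rewrite !subr0 s02 s12 !mulNr -opprD lerN2.
  rewrite !mul1r in h.
  have le1 : Num.max a 0 <= y ^+ 2 + z ^+ 2.
    by rewrite ge_max (ltW h)/= addr_ge0// sqr_ge0.
  rewrite ler_pdivrMr ?mulr_gt0//; apply: (le_trans le1).
  have -> : (y ^+ 2 / (l0 *+ 2) + z ^+ 2 / (l1 *+ 2)) * (2 * l0)
     = y ^+ 2 + z ^+ 2 * (l0 / l1) by field; rewrite !gt_eqF.
  by rewrite lerD2l ler_peMr ?sqr_ge0// ler_pdivlMr// mul1r.
apply: (@le_trans _ _ (K%:E * area a b)%E).
  rewrite /area -ge0_integralZl//; last 2 first.
  - exact: measurable_area_slice.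
  - by move=> y _; apply: integral_ge0.
  apply: ge0_le_integral => //.
  - by move=> y _; rewrite mule_ge0.
  - exact: emeasurable_funM.
  - by apply: emeasurable_funM => //; exact: measurable_area_slice.
  move=> y _; rewrite /G -ge0_integralZr//; last first.
    exact: (measurableT_comp mF (pair1_measurable y)).
  rewrite -ge0_integralZl//; last exact: measurable_planar_slice.
  apply: ge0_le_integral => //.
  - by move=> z _; rewrite mule_ge0.
  - apply: emeasurable_funM => //.
    exact: (measurableT_comp mF (pair1_measurable y)).
  - by apply: emeasurable_funM => //; exact: measurable_planar_slice.
  - by move=> z _; rewrite /F/= -!EFinM lee_fin; exact: pdf_le.
apply: (@le_trans _ _ (K%:E * (4 * (b - a))%:E)%E).
  by rewrite lee_wpmul2l ?lee_fin// area_le.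
rewrite -EFinM lee_fin /K (_ : normal_peak s0 * normal_peak s1
    = (2 * pi)^-1 * (Num.sqrt (l0 * l1))^-1); last first.
  have pk s : 0 < s -> normal_peak s = s^-1 * (Num.sqrt (2 * pi))^-1 :> R.
    move=> sp; rewrite /normal_peak -mulrnAr sqrtrM ?sqr_ge0// sqrtr_sqr.
    by rewrite gtr0_norm// invfM mulr_natl.
  have c2 : ((Num.sqrt (2 * pi))^-1) ^+ 2 = (2 * pi)^-1 :> R.
    by rewrite exprVn sqr_sqrtr// mulr_ge0// pi_ge0.
  by rewrite !pk// (sqrtrM _ (ltW l00)) -/s0 -/s1 -c2 invfM; ring.
set q := (Num.sqrt _)^-1; set D := b - a.
have q0 : 0 <= q by rewrite invr_ge0 sqrtr_ge0.
have D0 : 0 <= D by rewrite subr_ge0 ltW.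
have E0 : 0 <= E by exact: expR_ge0.
move: q D E q0 D0 E0 {K K0 pdf_le} => q D E q0 D0 E0.
have := @pi_ge2 R; move: (pi : R) => p p2.
have p0 : 0 < p by rewrite (lt_le_trans _ p2).
have -> : (2 * p)^-1 * q * E * (4 * D) = (2 / p) * (D * q * E).
  by field; exact: lt0r_neq0.
by rewrite ler_piMl ?mulr_ge0// ler_pdivrMr// mul1r.
Qed.

End gauss_annulus.

(** * Sums of squares of orthogonal Gaussian coordinates *)

Section bounded_fubini.
Context d1 (T1 : measurableType d1) d2 (T2 : measurableType d2) (R : realType).
Variables (P1 : probability T1 R) (P2 : probability T2 R).

Lemma Rintegral_swap (F : T1 * T2 -> R) K : measurable_fun setT F ->
  (forall p, `|F p| <= K) ->
  \int[P1]_x \int[P2]_y F (x, y) = \int[P2]_y \int[P1]_x F (x, y).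
Proof.
move=> mF FK.
have iF : (P1 \x P2)%E.-integrable setT (fun p => (F p)%:E).
  exact: (@prob_integrable _ _ _ (P1 \x P2)%E _ K).
have i2 x : P2.-integrable setT (fun y => (F (x, y))%:E).
  apply: (@prob_integrable _ _ _ P2 _ K) => //.
  exact: (measurableT_comp mF (pair1_measurable x)).
have i1 y : P1.-integrable setT (fun x => (F (x, y))%:E).
  apply: (@prob_integrable _ _ _ P1 _ K) => //.
  exact: (measurableT_comp mF (pair2_measurable y)).
rewrite /Rintegral; congr fine.
transitivity (\int[P1]_x \int[P2]_y (F (x, y))%:E)%E.
  apply: eq_integral => x _; rewrite fineK//; exact: (integrable_fin_num _ (i2 x)).
rewrite (Fubini iF); apply: eq_integral => y _.
by rewrite fineK//; exact: (integrable_fin_num _ (i1 y)).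
Qed.

End bounded_fubini.

Section same_law.
Context d1 (T1 : measurableType d1) d2 (T2 : measurableType d2) (R : realType).
Variables (P1 : probability T1 R) (P2 : probability T2 R).
Variables (X1 : T1 -> measurableTypeR R) (X2 : T2 -> measurableTypeR R).
Hypotheses (mX1 : measurable_fun setT X1) (mX2 : measurable_fun setT X2).
Hypothesis same_law : forall A : set (measurableTypeR R), measurable A ->
  P1 (X1 @^-1` A) = P2 (X2 @^-1` A).

Lemma ge0_integral_same_law (f : measurableTypeR R -> \bar R) :
  measurable_fun setT f -> (forall x, 0 <= f x)%E ->
  (\int[P1]_w f (X1 w) = \int[P2]_w f (X2 w))%E.
Proof.
move=> mf f0.
transitivity (\int[image_measure P1 mX1]_x f x)%E.
  by rewrite ge0_integral_pushforward.
transitivity (\int[image_measure P2 mX2]_x f x)%E.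
  by apply: eq_measure_integral => A mA _; exact: same_law.
by rewrite ge0_integral_pushforward.
Qed.

Lemma integral_same_law (f : measurableTypeR R -> \bar R) :
  measurable_fun setT f -> (\int[P1]_w f (X1 w) = \int[P2]_w f (X2 w))%E.
Proof.
move=> mf; rewrite integralE [RHS]integralE.
apply: (f_equal2 (fun x y => x - y)%E).
  transitivity (\int[P1]_w f^\+ (X1 w))%E.
    by apply: eq_integral => w _; rewrite !funeposE.
  rewrite (ge0_integral_same_law (measurable_funepos mf) (funepos_ge0 f)).
  by apply: eq_integral => w _; rewrite !funeposE.
transitivity (\int[P1]_w f^\- (X1 w))%E.
  by apply: eq_integral => w _; rewrite !funenegE.
rewrite (ge0_integral_same_law (measurable_funeneg mf) (funeneg_ge0 f)).
by apply: eq_integral => w _; rewrite !funenegE.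
Qed.

End same_law.

Section gaussian_family.
Context d (T : measurableType d) (R : realType) (P : probability T R).
Variables (V : lmodType R) (X : V -> T -> R) (b : V -> V -> R).
Local Notation q h := (b h h).
Local Notation gam := (gauss R).

Hypothesis mX : forall h, measurable_fun setT (X h).
Hypothesis XD : forall c h k w, X (h + c *: k) w = X h w + c * X k w.
Hypothesis bC : forall h k, b h k = b k h.
Hypothesis bD : forall c h k l, b (h + c *: k) l = b h l + c * b k l.
Hypothesis q_ge0 : forall h, 0 <= q h.
(** Joint laws are not given: only the law of each linear combination is. *)
Hypothesis lawX : forall h (A : set (measurableTypeR R)), measurable A ->
  P (X h @^-1` A) = gam ((fun z => Num.sqrt (q h) * z) @^-1` A).

Lemma qD c h k : b h k = 0 -> q (h + c *: k) = q h + c ^+ 2 * q k.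
Proof. by move=> hk; rewrite bD (bC h (h + c *: k)) (bC k (h + c *: k)) !bD (bC k h) hk; ring. Qed.

Lemma ms_scale h : measurable_fun [set: measurableTypeR R]
  (fun z : measurableTypeR R => Num.sqrt (q h) * z : measurableTypeR R).
Proof. exact: measurable_funM. Qed.

Lemma ge0_integral_law h (f : measurableTypeR R -> \bar R) :
  measurable_fun setT f -> (forall x, 0 <= f x)%E ->
  (\int[P]_w f (X h w) = \int[gam]_z f (Num.sqrt (q h) * z)%R)%E.
Proof. exact: (ge0_integral_same_law (mX h) (ms_scale h) (lawX h)). Qed.

Lemma integral_law h (f : measurableTypeR R -> \bar R) :
  measurable_fun setT f ->
  (\int[P]_w f (X h w) = \int[gam]_z f (Num.sqrt (q h) * z)%R)%E.
Proof. exact: (integral_same_law (mX h) (ms_scale h) (lawX h)). Qed.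

Lemma Rintegral_cos_law h : \int[P]_w cos (X h w) = expR (- (q h / 2)).
Proof.
rewrite /Rintegral (@integral_law h (fun x => (cos x)%:E)).
  rewrite -[LHS]/(gauss_cos (Num.sqrt (q h))) gauss_cosE.
  by rewrite sqr_sqrtr.
apply/measurable_EFinP; apply: continuous_measurable_fun; exact: continuous_cos.
Qed.

Lemma integral_expR_law h :
  (\int[P]_w (expR (X h w))%:E = (expR (q h / 2))%:E)%E.
Proof.
rewrite (@ge0_integral_law h (fun x => (expR x)%:E)).
- by rewrite integral_gauss_expR sqr_sqrtr.
- by apply/measurable_EFinP; exact: measurable_expR.
- by move=> x; rewrite lee_fin expR_ge0.
Qed.

Definition sumsq (s : seq V) (w : T) : R := \sum_(v <- s) X v w ^+ 2.

Lemma sumsq_cons v s w : sumsq (v :: s) w = X v w ^+ 2 + sumsq s w.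
Proof. by rewrite /sumsq big_cons. Qed.

Lemma sumsq_ge0 s w : 0 <= sumsq s w.
Proof. by apply: sumr_ge0 => v _; exact: sqr_ge0. Qed.

Lemma measurable_sumsq s : measurable_fun setT (sumsq s).
Proof.
elim: s => [|v s IH].
  by rewrite (_ : sumsq _ = cst 0)//; apply/funext => w; rewrite /sumsq big_nil.
rewrite (_ : sumsq _ = (fun w => X v w ^+ 2 + sumsq s w)).
  by apply: measurable_funD => //; apply: measurable_funX.
by apply/funext => w; rewrite sumsq_cons.
Qed.

(** Averaging over an auxiliary Gaussian [c] trades an exponent quadratic in [x]
    for an argument linear in [x]. *)
Lemma expR_sqr_cos t x : 0 <= t ->
  expR (- (t * x ^+ 2 / 2)) = \int[gam]_c cos (Num.sqrt t * x * c).
Proof.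
move=> t0; rewrite -[RHS]/(gauss_cos (Num.sqrt t * x)) gauss_cosE exprMn.
by rewrite sqr_sqrtr.
Qed.

(** By induction on [s]. The square of the first coordinate is linearised by an
    auxiliary Gaussian [c]; the product of the two cosines is the mean of the
    cosines of [X (h + k *: e)] and [X (h - k *: e)] with [k = sqrt t c], to
    which the induction hypothesis applies because [h + a *: e] is still
    orthogonal to the rest. Only laws of single [X h] enter. *)
Lemma Rintegral_cos_sumsq t s h : 0 <= t ->
  pairwise (fun u v => b u v == 0) s -> all (fun v => b h v == 0) s ->
  \int[P]_w (cos (X h w) * expR (- (t * sumsq s w / 2))) =
  expR (- (q h / 2)) * \prod_(v <- s) (Num.sqrt (1 + t * q v))^-1.
Proof.
move=> t0; elim: s h => [|e s IH] h /=.
  move=> _ _; rewrite big_nil mulr1 -Rintegral_cos_law.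
  apply: eq_Rintegral => w _.
  by rewrite /sumsq big_nil mulr0 mul0r oppr0 expR0 mulr1.
move=> /andP[es ss] /andP[/eqP he hs].
pose W w := expR (- (t * sumsq s w / 2)).
have mW : measurable_fun [set: T] W.
  apply: measurableT_comp => //; apply: measurableT_comp => //.
  apply: measurable_funM => //; apply: measurable_funM => //.
  exact: measurable_sumsq.
have W0 w : 0 <= W w by exact: expR_ge0.
have W1 w : W w <= 1.
  rewrite -expR0 ler_expR oppr_le0 divr_ge0// mulr_ge0//.
  exact: sumsq_ge0.
pose F (p : T * measurableTypeR R) :=
  cos (X h p.1) * W p.1 * cos (Num.sqrt t * X e p.1 * p.2).
have mcos : measurable_fun [set: R] (@cos R).
  by apply: continuous_measurable_fun; exact: continuous_cos.
have mF : measurable_fun setT F.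
  apply: measurable_funM.
    apply: measurable_funM.
      exact: (measurableT_comp mcos (measurableT_comp (mX h) (@measurable_fst _ _ _ _))).
    exact: (measurableT_comp mW (@measurable_fst _ _ _ _)).
  apply: (measurableT_comp mcos); apply: measurable_funM => //.
  apply: measurable_funM => //.
  exact: (measurableT_comp (mX e) (@measurable_fst _ _ _ _)).
have F1 p : `|F p| <= 1.
  rewrite /F !normrM (ger0_norm (W0 _)).
  by rewrite mulr_ile1 ?mulr_ge0 ?norm_cos_le1// mulr_ile1 ?norm_cos_le1.
transitivity (\int[P]_w \int[gam]_c F (w, c)).
  apply: eq_Rintegral => w _; rewrite sumsq_cons /F/=.
  rewrite RintegralZl//; last exact: gauss_integrable_cos.
  rewrite -expR_sqr_cos// -[RHS]mulrA; congr (_ * _).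
  by rewrite /W -expRD; congr expR; ring.
rewrite (Rintegral_swap P gam mF F1).
have inner c : \int[P]_w F (w, c) = expR (- (q h / 2))
    * (\prod_(v <- s) (Num.sqrt (1 + t * q v))^-1)
    * expR (- (t * q e * c ^+ 2 / 2)).
  pose k := Num.sqrt t * c.
  have k2 : k ^+ 2 = t * c ^+ 2 by rewrite exprMn sqr_sqrtr.
  have orth a : all (fun v => b (h + a *: e) v == 0) s.
    apply/allP => v vs; rewrite bD (eqP (allP hs _ vs)) (eqP (allP es _ vs)).
    by rewrite mulr0 addr0.
  have ic a : P.-integrable setT
      (fun w => (2^-1 * (cos (X (h + a *: e) w) * W w))%:E).
    apply: (@prob_integrable _ _ _ P _ 1).
      by apply: measurable_funM => //; apply: measurable_funM => //;
        exact: measurableT_comp.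
    move=> w; rewrite !normrM (ger0_norm (W0 _)) ger0_norm ?invr_ge0//.
    rewrite mulr_ile1 ?invr_ge0 ?mulr_ge0 ?invf_le1 ?ler1n//.
    by rewrite mulr_ile1 ?norm_cos_le1.
  transitivity (\int[P]_w (2^-1 * (cos (X (h + k *: e) w) * W w))
    + \int[P]_w (2^-1 * (cos (X (h + (- k) *: e) w) * W w))).
    rewrite -RintegralD//; try exact: ic.
    apply: eq_Rintegral => w _; rewrite /F /= !XD mulNr cosB cosD -/k.
    rewrite (_ : Num.sqrt t * X e w * c = k * X e w); last by rewrite /k; ring.
    by field.
  have half a : \int[P]_w (2^-1 * (cos (X (h + a *: e) w) * W w)) =
    2^-1 * (expR (- (q (h + a *: e) / 2))
      * \prod_(v <- s) (Num.sqrt (1 + t * q v))^-1).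
    rewrite RintegralZl//; first by rewrite /W IH.
    apply: (@prob_integrable _ _ _ P _ 1).
      by apply: measurable_funM => //; exact: measurableT_comp.
    move=> w; rewrite !normrM (ger0_norm (W0 _)).
    by rewrite mulr_ile1 ?norm_cos_le1.
  rewrite !half !qD// sqrrN k2.
  rewrite [expR (- ((q h + _) / 2))](_ : _ = expR (- (q h / 2))
     * expR (- (t * q e * c ^+ 2 / 2))); last by rewrite -expRD; congr expR; ring.
  by field.
under eq_Rintegral do rewrite inner.
have te : -1 < t * q e by rewrite (lt_le_trans _ (mulr_ge0 t0 (q_ge0 e)))// ltrN10.
have ig : gam.-integrable setT (fun c => (expR (- (t * q e * c ^+ 2 / 2)))%:E).
  apply: (@prob_integrable _ _ _ gam _ 1).
    apply: measurableT_comp => //; apply: measurableT_comp => //.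
    by apply: measurable_funM => //; apply: measurable_funM.
  move=> c; rewrite ger0_norm ?expR_ge0// -expR0 ler_expR oppr_le0.
  by rewrite divr_ge0// mulr_ge0 ?sqr_ge0// mulr_ge0.
rewrite RintegralZl// big_cons -mulrA; congr (_ * _).
by rewrite mulrC /Rintegral integral_gauss_expR_sqr.
Qed.

(** The same induction with exponentials in place of cosines; positivity
    replaces boundedness in the exchange of integrals. *)
Lemma integral_expR_sumsq t s h : 0 <= t ->
  pairwise (fun u v => b u v == 0) s -> all (fun v => b h v == 0) s ->
  all (fun v => t * q v < 1) s ->
  (\int[P]_w (expR (X h w + t * sumsq s w / 2))%:E =
  (expR (q h / 2) * \prod_(v <- s) (Num.sqrt (1 - t * q v))^-1)%:E)%E.
Proof.
move=> t0; elim: s h => [|e s IH] h /=.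
  move=> _ _ _; rewrite big_nil mulr1 -integral_expR_law.
  by apply: eq_integral => w _; rewrite /sumsq big_nil mulr0 mul0r addr0.
move=> /andP[es ss] /andP[/eqP he hs] /andP[te ts].
pose F (p : T * measurableTypeR R) :=
  (expR (X h p.1 + t * sumsq s p.1 / 2 + Num.sqrt t * X e p.1 * p.2))%:E.
have mfst := @measurable_fst _ _ T (measurableTypeR R).
have mF : measurable_fun setT F.
  apply/measurable_EFinP; apply: measurableT_comp => //.
  apply: measurable_funD.
    apply: measurable_funD; first exact: (measurableT_comp (mX h) mfst).
    apply: measurable_funM => //; apply: measurable_funM => //.
    exact: (measurableT_comp (measurable_sumsq s) mfst).
  apply: measurable_funM => //; apply: measurable_funM => //.
  exact: (measurableT_comp (mX e) mfst).
have F0 p : (0 <= F p)%E by rewrite lee_fin expR_ge0.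
transitivity (\int[P]_w \int[gam]_c F (w, c))%E.
  apply: eq_integral => w _; rewrite /F/=.
  under eq_integral do rewrite expRD EFinM.
  rewrite ge0_integralZl//; last first.
    by apply/measurable_EFinP; exact: measurable_expRM.
  rewrite integral_gauss_expR -EFinM -expRD exprMn sqr_sqrtr// sumsq_cons.
  by congr (expR _)%:E; ring.
rewrite (fubini_tonelli _ mF F0).
transitivity (\int[gam]_c ((expR (q h / 2)
   * \prod_(v <- s) (Num.sqrt (1 - t * q v))^-1)%:E
   * (expR (- (- (t * q e) * c ^+ 2 / 2)))%:E))%E.
  apply: eq_integral => c _.
  transitivity (\int[P]_w (expR (X (h + (Num.sqrt t * c) *: e) w
                               + t * sumsq s w / 2))%:E)%E.
    by apply: eq_integral => w _; rewrite /F XD/=; congr (expR _)%:E; ring.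
  rewrite IH//; last first.
    apply/allP => v vs; rewrite bD (eqP (allP hs _ vs)) (eqP (allP es _ vs)).
    by rewrite mulr0 addr0.
  rewrite qD// exprMn sqr_sqrtr// -EFinM; congr EFin.
  by rewrite [RHS]mulrAC -expRD; congr (expR _ * _); ring.
rewrite ge0_integralZl//; last 2 first.
- apply/measurable_EFinP; apply: measurableT_comp => //.
  apply: measurableT_comp => //; apply: measurable_funM => //.
  by apply: measurable_funM.
- by rewrite lee_fin mulr_ge0 ?expR_ge0// prodr_ge0.
rewrite integral_gauss_expR_sqr ?ltrN2// -EFinM big_cons -mulrA.
by congr (_ * _)%:E; rewrite mulrC.
Qed.

Lemma X0 w : X 0 w = 0.
Proof.
have := XD 1 0 0 w; rewrite scaler0 addr0 mul1r => /eqP.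
by rewrite -subr_eq0 opprD addrA subrr sub0r oppr_eq0 => /eqP.
Qed.

Lemma b0l v : b 0 v = 0.
Proof.
have := bD 1 0 0 v; rewrite scaler0 addr0 mul1r => /eqP.
by rewrite -subr_eq0 opprD addrA subrr sub0r oppr_eq0 => /eqP.
Qed.

Lemma Rintegral_expRN_sumsq t s : 0 <= t ->
  pairwise (fun u v => b u v == 0) s ->
  \int[P]_w expR (- (t * sumsq s w / 2)) =
  \prod_(v <- s) (Num.sqrt (1 + t * q v))^-1.
Proof.
move=> t0 ps; have := @Rintegral_cos_sumsq t s 0 t0 ps.
rewrite b0l mul0r oppr0 expR0 mul1r => <-.
  by apply: eq_Rintegral => w _; rewrite X0 cos0 mul1r.
by apply/allP => v _; rewrite b0l.
Qed.

Local Notation I lo hi := (\1_(`]lo, hi[%classic) : R -> R).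

(** A weak form of the independence of orthogonal coordinates. The two variables
    have the same Laplace transform, so their exponentials [exp (- S)] have the
    same moments and hence the same law. *)
Lemma integral_sumsq_cons e s (lo hi : R) :
  pairwise (fun u v => b u v == 0) (e :: s) ->
  (\int[P]_w (I lo hi (sumsq (e :: s) w))%:E =
   \int[gam]_z \int[P]_w (I lo hi (q e * z ^+ 2 + sumsq s w))%:E)%E.
Proof.
move=> pes; have ps : pairwise (fun u v => b u v == 0) s.
  by move: pes => /= /andP[].
pose Q := (P \x gam)%E : probability _ R.
pose S2 (p : T * measurableTypeR R) := q e * p.2 ^+ 2 + sumsq s p.1.
have mS2 : measurable_fun setT S2.
  apply: measurable_funD; last first.
    exact: (measurableT_comp (measurable_sumsq s) (@measurable_fst _ _ _ _)).
  by apply: measurable_funM => //; apply: measurable_funX.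
have S20 p : 0 <= S2 p by rewrite addr_ge0 ?sumsq_ge0// mulr_ge0// sqr_ge0.
pose U1 w := expR (- sumsq (e :: s) w); pose U2 p := expR (- S2 p).
have expN01 (x : R) : 0 <= x -> 0 <= expR (- x) <= 1.
  by move=> x0; rewrite expR_ge0/= -expR0 ler_expR oppr_le0.
have mU1 : measurable_fun setT U1.
  apply: measurableT_comp => //; apply: measurableT_comp => //.
  exact: measurable_sumsq.
have mU2 : measurable_fun setT U2.
  by apply: measurableT_comp => //; apply: measurableT_comp.
have moments k : \int[P]_w (U1 w ^+ k) = \int[Q]_p (U2 p ^+ k).
  have t0 : (0 : R) <= 2 * k%:R by rewrite mulr_ge0.
  transitivity (\prod_(v <- e :: s) (Num.sqrt (1 + (2 * k%:R) * q v))^-1).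
    rewrite -Rintegral_expRN_sumsq//; apply: eq_Rintegral => w _.
    by rewrite /U1 -expRM_natl; congr expR; field.
  pose F (p : T * measurableTypeR R) := (U2 p ^+ k)%:E.
  have mF : measurable_fun setT F by apply/measurable_EFinP; apply: measurable_funX.
  have F0 p : (0 <= F p)%E by rewrite lee_fin exprn_ge0// expR_ge0.
  rewrite /Rintegral -/F (fubini_tonelli1 _ mF F0).
  transitivity (fine (\int[P]_w
     ((Num.sqrt (1 + (2 * k%:R) * q e))^-1 * expR (- (2 * k%:R * sumsq s w / 2)))%:E)%E).
    rewrite -[RHS]/(Rintegral _ _ _) RintegralZl//.
      by rewrite Rintegral_expRN_sumsq// big_cons.
    apply: (@prob_integrable _ _ _ P _ 1).
      apply: measurableT_comp => //; apply: measurableT_comp => //.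
      apply: measurable_funM => //; apply: measurable_funM => //.
      exact: measurable_sumsq.
    move=> w; rewrite ger0_norm ?expR_ge0// -expR0 ler_expR oppr_le0.
    by rewrite divr_ge0// mulr_ge0 ?sumsq_ge0.
  congr fine; apply: eq_integral => w _; rewrite EFinM -integral_gauss_expR_sqr.
    rewrite -ge0_integralZr//; last first.
      apply/measurable_EFinP; apply: measurableT_comp => //.
      by apply: measurableT_comp => //; apply: measurable_funM => //; apply: measurable_funM.
    apply: eq_integral => z _.
    rewrite -EFinM -expRD /F /U2 /S2/= -expRM_natl.
    by congr (expR _)%:E; field.
  by rewrite (lt_le_trans _ (mulr_ge0 t0 (q_ge0 e)))// ltrN10.
have := @moments_eq_interval R _ _ _ _ P Q U1 U2 mU1 mU2 _ _ moments (expR (- hi)) (expR (- lo)).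
have E d' (T' : measurableType d') (P' : probability T' R) (S : T' -> R) :
    measurable_fun setT S ->
    P' [set w | expR (- hi) < expR (- S w) < expR (- lo)]
    = (\int[P']_w (I lo hi (S w))%:E)%E.
  move=> mS; rewrite -prob_intervalE//; congr (P' _).
  by apply/seteqP; split => w /=; rewrite !ltr_expR !ltrN2 andbC.
rewrite /U1 /U2 E ?E//; last exact: measurable_sumsq.
move=> -> //; last 2 first.
- by move=> w; apply: expN01; exact: sumsq_ge0.
- by move=> w; apply: expN01; exact: S20.
have mI : measurable_fun setT (fun p => (I lo hi (S2 p))%:E).
  apply/measurable_EFinP; exact: (measurableT_comp (measurable_indic_oo lo hi) mS2).
rewrite /Q (fubini_tonelli1 _ mI); last by move=> p; rewrite lee_fin.
by rewrite (fubini_tonelli _ mI)// => p; rewrite lee_fin.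
Qed.

(** Both of the first two squares are made independent of the rest, and the
    rest is then frozen. *)
Lemma integral_sumsq_le e0 e1 s (lo hi : R) :
  pairwise (fun u v => b u v == 0) [:: e0, e1 & s] ->
  0 < q e1 -> q e1 <= q e0 -> lo < hi ->
  (\int[P]_w (I lo hi (sumsq [:: e0, e1 & s] w))%:E <=
   \int[P]_w ((hi - lo) / Num.sqrt (q e0 * q e1)
     * expR (- (Num.max (lo - sumsq s w) 0 / (2 * q e0))))%:E)%E.
Proof.
move=> ps q1 q10 lohi; rewrite integral_sumsq_cons//.
pose F (p : (measurableTypeR R * T) * measurableTypeR R) :=
  (I lo hi (q e0 * p.1.1 ^+ 2 + q e1 * p.2 ^+ 2 + sumsq s p.1.2))%:E.
have mF : measurable_fun setT F.
  apply/measurable_EFinP; apply: (measurableT_comp (measurable_indic_oo lo hi)).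
  apply: measurable_funD; last first.
    apply: (measurableT_comp (measurable_sumsq s)).
    exact: measurableT_comp.
  apply: measurable_funD; apply: measurable_funM => //; apply: measurable_funX => //.
  exact: measurableT_comp.
have F0 p : (0 <= F p)%E by rewrite lee_fin.
have -> : (\int[gam]_z \int[P]_w (I lo hi (q e0 * z ^+ 2 + sumsq (e1 :: s) w))%:E
    = \int[gam]_y \int[P]_w \int[gam]_z F ((y, w), z))%E.
  apply: eq_integral => y _.
  have shift (t c : R) : I lo hi (c + t) = I (lo - c) (hi - c) t.
    by rewrite !indicE !mem_oo ltrBlDl ltrBrDl.
  under eq_integral do rewrite shift.
  rewrite integral_sumsq_cons; last by move: ps => /= /andP[_ ->].
  pose Fy (p : T * measurableTypeR R) := F ((y, p.1), p.2).
  have mFy : measurable_fun setT Fy.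
    apply: (measurableT_comp mF); apply: measurable_fun_pair => //.
    by apply: measurable_fun_pair => //; exact: measurable_cst.
  have := fubini_tonelli (m1 := P) (m2 := gam) Fy mFy (fun p => F0 _).
  move=> ->; apply: eq_integral => z _; apply: eq_integral => w _.
  by rewrite /Fy /F/= -shift addrA.
pose H (p : measurableTypeR R * T) := (\int[gam]_z F (p, z))%E.
have mH : measurable_fun setT H by exact: measurable_fun_fubini_tonelli_F.
have H0 p : (0 <= H p)%E by apply: integral_ge0 => z _; exact: F0.
rewrite (fubini_tonelli (m1 := gam) (m2 := P) H mH H0).
have mrhs : measurable_fun [set: T] (fun w => ((hi - lo) / Num.sqrt (q e0 * q e1)
     * expR (- (Num.max (lo - sumsq s w) 0 / (2 * q e0))))%:E).
  apply/measurable_EFinP; apply: measurable_funM => //; apply: measurableT_comp => //.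
  apply: measurableT_comp => //; apply: measurable_funM => //.
  apply: measurable_maxr => //; apply: measurable_funB => //.
  exact: measurable_sumsq.
apply: ge0_le_integral => //.
- by move=> w _; apply: integral_ge0.
- exact: (@measurable_fun_fubini_tonelli_G _ _ _ _ _ gam H).
move=> w _; have lohi' : lo - sumsq s w < hi - sumsq s w by rewrite ltrD2r.
apply: le_trans (le_trans (gauss_annulus q1 q10 lohi') _).
  rewrite le_eqVlt; apply/orP; left; apply/eqP.
  apply: eq_integral => y _; apply: eq_integral => z _.
  by rewrite /F/= !indicE !mem_oo ltrBlDr ltrBrDr.
by rewrite (_ : hi - sumsq s w - (lo - sumsq s w) = hi - lo)//; ring.
Qed.

Lemma sumsq_concentration e0 e1 s (lo hi : R) :
  pairwise (fun u v => b u v == 0) [:: e0, e1 & s] ->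
  0 < q e1 -> q e1 <= q e0 -> lo < hi ->
  (P [set w | (lo < sumsq [:: e0, e1 & s] w < hi)%R]
   <= ((hi - lo) / Num.sqrt (q e0 * q e1))%:E)%E.
Proof.
move=> ps q1 q10 lohi; rewrite prob_intervalE; last exact: measurable_sumsq.
apply: (le_trans (integral_sumsq_le ps q1 q10 lohi)).
set K := _ / _; rewrite -[leRHS](integral_prob_cst P).
have K0 : 0 <= K by rewrite divr_ge0// subr_ge0 ltW.
have q0 : 0 < q e0 by exact: lt_le_trans q10.
apply: ge0_le_integral => //.
- by move=> w _; rewrite lee_fin mulr_ge0// expR_ge0.
- apply/measurable_EFinP; apply: measurable_funM => //; apply: measurableT_comp => //.
  apply: measurableT_comp => //; apply: measurable_funM => //.
  apply: measurable_maxr => //; apply: measurable_funB => //.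
  exact: measurable_sumsq.
- move=> w _; rewrite lee_fin ler_piMr// -expR0 ler_expR oppr_le0.
  by rewrite divr_ge0 ?mulr_ge0 ?(ltW q0)// le_max lexx orbT.
Qed.

Lemma sumsq_concentration_exp e0 e1 s (lo hi l : R) :
  pairwise (fun u v => b u v == 0) [:: e0, e1 & s] ->
  0 < q e1 -> q e1 <= q e0 -> lo < hi -> q e0 < l ->
  all (fun v => q v < l) s ->
  (P [set w | (lo < sumsq [:: e0, e1 & s] w < hi)%R]
   <= ((hi - lo) / Num.sqrt (q e0 * q e1)
        * (expR (- (lo / (2 * l))) * \prod_(v <- s) (Num.sqrt (1 - q v / l))^-1))%:E)%E.
Proof.
move=> ps q1 q10 lohi ql qs; rewrite prob_intervalE; last exact: measurable_sumsq.
apply: (le_trans (integral_sumsq_le ps q1 q10 lohi)).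
set K := _ / Num.sqrt _.
have K0 : 0 <= K by rewrite divr_ge0// subr_ge0 ltW.
have q0 : 0 < q e0 by exact: lt_le_trans q10.
have l0 : 0 < l by exact: lt_trans ql.
have mS := measurable_sumsq s.
have mexp : measurable_fun [set: T] (fun w => expR (X 0 w + l^-1 * sumsq s w / 2)).
  apply: measurableT_comp => //; apply: measurable_funD => //.
  by apply: measurable_funM => //; apply: measurable_funM.
apply: (@le_trans _ _ (\int[P]_w ((K * expR (- (lo / (2 * l))))%:E *
   (expR (X 0 w + l^-1 * sumsq s w / 2))%:E))%E).
  apply: ge0_le_integral => //.
  - by move=> w _; rewrite lee_fin mulr_ge0// expR_ge0.
  - apply/measurable_EFinP; apply: measurable_funM => //; apply: measurableT_comp => //.
    apply: measurableT_comp => //; apply: measurable_funM => //.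
    by apply: measurable_maxr => //; apply: measurable_funB.
  - by apply: emeasurable_funM => //; exact/measurable_EFinP.
  move=> w _; rewrite -EFinM lee_fin -[leRHS]mulrA ler_wpM2l// -expRD ler_expR.
  rewrite X0 add0r; set r := sumsq s w; set m := Num.max _ _.
  rewrite (_ : - (lo / (2 * l)) + l^-1 * r / 2 = - ((lo - r) / (2 * l))); last first.
    by field; rewrite gt_eqF.
  rewrite lerN2 (@le_trans _ _ (m / (2 * l)))//.
    by rewrite ler_wpM2r ?invr_ge0 ?mulr_ge0 ?(ltW l0)// le_max lexx.
  have m0 : 0 <= m by rewrite le_max lexx orbT.
  by rewrite ler_wpM2l// lef_pV2 ?posrE ?mulr_gt0// ler_pM2l// ltW.
rewrite ge0_integralZl//; last 2 first.
- exact/measurable_EFinP.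
- by rewrite lee_fin mulr_ge0// expR_ge0.
rewrite integral_expR_sumsq.
- rewrite b0l mul0r expR0 mul1r -EFinM lee_fin mulrA.
  by under eq_bigr do rewrite mulrC.
- by rewrite invr_ge0 ltW.
- by move: ps => /= /and3P[_ _ ->].
- by apply/allP => v _; rewrite b0l.
- apply/allP => v vs; rewrite mulrC ltr_pdivrMr// mul1r.
  exact: (allP qs).
Qed.

End gaussian_family.

(** * Hilbert spaces and power iteration *)

Section hilbert.
Context (R : realType) (H : completeNormedModType R).
Variable ip : {dot H for @idfun R}.
Hypothesis ipE : forall u : H, `|u| ^+ 2 = ip u u.
Implicit Types (u v w : H) (c : R).

Lemma ipC u v : ip u v = ip v u.
Proof. by rewrite hermC expr0 mul1r. Qed.

Lemma ipD c u v w : ip (u + c *: v) w = ip u w + c * ip v w.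
Proof. by rewrite linearDl linearZl_LR. Qed.

Lemma ipDr c u v w : ip w (u + c *: v) = ip w u + c * ip w v.
Proof. by rewrite ipC ipD !(ipC _ w). Qed.

Lemma ipZ c u v : ip (c *: u) v = c * ip u v.
Proof. by rewrite linearZl_LR. Qed.

Lemma ipZr c u v : ip u (c *: v) = c * ip u v.
Proof. by rewrite ipC ipZ ipC. Qed.

Lemma ipB u v w : ip (u - v) w = ip u w - ip v w.
Proof. by rewrite linearBl. Qed.

Lemma ipBr u v w : ip w (u - v) = ip w u - ip w v.
Proof. by rewrite ipC ipB !(ipC _ w). Qed.

Lemma ip0l u : ip 0 u = 0.
Proof. by rewrite linear0l. Qed.

Lemma ip0r u : ip u 0 = 0.
Proof. by rewrite ipC ip0l. Qed.

Lemma ip_ge0 u : 0 <= ip u u.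
Proof. by rewrite -ipE sqr_ge0. Qed.

Lemma ip_eq0 u : ip u u = 0 -> u = 0.
Proof. by rewrite -ipE => /eqP; rewrite sqrf_eq0 normr_eq0 => /eqP. Qed.

End hilbert.

Section positive_form.
Context (R : realType) (V : lmodType R) (b : V -> V -> R).
Hypothesis bC : forall h k, b h k = b k h.
Hypothesis bD : forall c h k l, b (h + c *: k) l = b h l + c * b k l.
Hypothesis b_ge0 : forall h, 0 <= b h h.

Lemma form_cauchy_schwarz u v : b u v ^+ 2 <= b u u * b v v.
Proof.
have Q c : 0 <= b u u + 2 * c * b u v + c ^+ 2 * b v v.
  have := b_ge0 (u + c *: v).
  rewrite bD (bC u (u + c *: v)) (bC v (u + c *: v)) !bD (bC v u).
  by congr (_ <= _); ring.
have [v0|v0] := eqVneq (b v v) 0.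
  rewrite v0 mulr0; have [->|uv] := eqVneq (b u v) 0; first by rewrite expr0n.
  have := Q (- (b u u + 1) / (2 * b u v)); rewrite v0.
  have -> : b u u + 2 * (- (b u u + 1) / (2 * b u v)) * b u v +
    (- (b u u + 1) / (2 * b u v)) ^+ 2 * 0 = -1 by field.
  by rewrite oppr_ge0 ler10.
have v1 : 0 < b v v by rewrite lt_neqAle eq_sym v0 b_ge0.
have := Q (- b u v / b v v).
have -> : b u u + 2 * (- b u v / b v v) * b u v + (- b u v / b v v) ^+ 2 * b v v
  = (b u u * b v v - b u v ^+ 2) / b v v by field.
by rewrite pmulr_lge0 ?invr_gt0// subr_ge0.
Qed.

End positive_form.

Section hilbert_norm.
Context (R : realType) (H : completeNormedModType R).
Variable ip : {dot H for @idfun R}.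
Hypothesis ipE : forall u : H, `|u| ^+ 2 = ip u u.
Implicit Types (u v w : H) (c : R).

Lemma ip_cauchy_schwarz u v : `|ip u v| <= `|u| * `|v|.
Proof.
rewrite -ler_sqr ?nnegrE ?mulr_ge0// real_normK ?num_real// exprMn !ipE.
exact: (form_cauchy_schwarz (ipC ip) (ipD ip) (ip_ge0 ipE)).
Qed.

Lemma normB_sqr u v : `|u - v| ^+ 2 = `|u| ^+ 2 - 2 * ip u v + `|v| ^+ 2.
Proof.
rewrite !ipE ipB !ipBr (ipC ip v u); ring.
Qed.

Lemma lipschitz_continuous (f : H -> R) (M : R) :
  (forall u v, `|f u - f v| <= M * `|u - v|) -> continuous f.
Proof.
move=> fM u; apply/cvgrPdist_le => /= e e0; near=> v.
rewrite (le_trans (fM _ _))//.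
apply: (@le_trans _ _ ((`|M| + 1) * `|u - v|)).
  by rewrite ler_wpM2r// (le_trans (ler_norm M))// lerDl.
rewrite mulrC -ler_pdivlMr ?ltr_wpDl//; near: v.
apply: cvgr_dist_le; first exact: cvg_id.
by rewrite divr_gt0// ltr_wpDl.
Unshelve. all: by end_near. Qed.

Lemma ip_continuous v : continuous (fun u => ip u v).
Proof.
apply: (@lipschitz_continuous _ `|v|) => u w.
by rewrite -ipB mulrC ip_cauchy_schwarz.
Qed.

Lemma cauchy_sqr_cvg (x : nat -> H) (a : R^nat) : cvgn a ->
  (forall i j, (i <= j)%N -> `|x i - x j| ^+ 2 <= `|a i - a j|) -> cvgn x.
Proof.
move=> ca xa; apply: cauchy_cvg; apply: cauchy_exP => e e0.
have e20 : 0 < e ^+ 2 / 2 by rewrite divr_gt0// exprn_gt0.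
have /cvgrPdist_lt/(_ _ e20) [N _ hN] := ca.
exists (x N); exists N => // j /= Nj; rewrite -ball_normE /=.
rewrite -ltr_sqr ?nnegrE ?(ltW e0)// (le_lt_trans (xa _ _ Nj))//.
have h1 := hN N (leqnn N); have h2 := hN j Nj; rewrite /= in h1 h2.
rewrite (_ : a N - a j = (limn a - a j) - (limn a - a N)); last by ring.
by rewrite (le_lt_trans (ler_normB _ _))// [ltRHS]splitr ltrD.
Qed.

End hilbert_norm.

Section power_iteration.
Context (R : realType) (H : completeNormedModType R).
Variable ip : {dot H for @idfun R}.
Hypothesis ipE : forall u : H, `|u| ^+ 2 = ip u u.
Implicit Types (u v w : H) (c : R).

Variable B : H -> H.
Hypothesis BD : forall c u v, B (u + c *: v) = B u + c *: B v.
Hypothesis Bsym : forall u v, ip (B u) v = ip u (B v).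
Hypothesis B_ge0 : forall u, 0 <= ip (B u) u.
Hypothesis B_le : forall u, ip (B u) u <= `|u| ^+ 2.

(** The Cauchy-Schwarz inequality for the form [<B u, v>], at [u] and [B u]. *)
Lemma normB_le_form u : `|B u| ^+ 2 <= ip (B u) u.
Proof.
have := @form_cauchy_schwarz _ _ (fun u v => ip (B u) v) _ _ B_ge0 u (B u).
have bC h k : ip (B h) k = ip (B k) h by rewrite Bsym ipC.
have bD c h k l : ip (B (h + c *: k)) l = ip (B h) l + c * ip (B k) l.
  by rewrite BD ipD.
move=> /(_ bC bD); rewrite -ipE => h.
have [->|n0] := eqVneq (`|B u| ^+ 2) 0; first exact: B_ge0.
have n1 : 0 < `|B u| ^+ 2 by rewrite lt_neqAle eq_sym n0 sqr_ge0.
rewrite -(ler_pM2r n1) -expr2; apply: (le_trans h).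
by rewrite ler_wpM2l.
Qed.

Lemma norm_contract u : `|B u| <= `|u|.
Proof.
rewrite -ler_sqr ?nnegrE//.
exact: le_trans (normB_le_form u) (B_le u).
Qed.

Lemma iter_contract n u : `|iter n B u| <= `|u|.
Proof. by elim: n => //= n IH; exact: le_trans (norm_contract _) IH. Qed.

Lemma iterBD n c u v : iter n B (u + c *: v) = iter n B u + c *: iter n B v.
Proof. by elim: n => //= n ->. Qed.

Lemma iter_sym n u v : ip (iter n B u) v = ip u (iter n B v).
Proof. by elim: n v => //= n IH v; rewrite Bsym IH -iterSr. Qed.

Lemma iter_lipschitz n u v : `|iter n B u - iter n B v| <= `|u - v|.
Proof.
have -> : iter n B u - iter n B v = iter n B (u - v).
  by rewrite -[in RHS]scaleN1r iterBD scaleN1r.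
exact: iter_contract.
Qed.

(** For a positive contraction the norms of the iterates decrease, and an even
    number of further steps moves the iterate by no more than this decrease. *)
Lemma iter_increment u i k :
  `|iter k B u - iter (i.*2 + k) B u| ^+ 2
    <= `|iter k B u| ^+ 2 - `|iter (i.*2 + k) B u| ^+ 2.
Proof.
rewrite iterD; set v := iter k B u.
have -> : iter i.*2 B v = iter i B (iter i B v) by rewrite -iterD addnn.
rewrite (normB_sqr ipE) -iter_sym -ipE.
have := iter_contract i (iter i B v); rewrite -ler_sqr ?nnegrE// => h; lra.
Qed.

(** The even iterates converge to a fixed vector [z] of [B ^ 2]. Positivity of
    [B] excludes the eigenvalue [-1], so that [z] is fixed by [B] itself. *)
Lemma power_iteration_fixpoint u :
  ~ (`|iter k.*2 B u| ^+ 2 @[k --> \oo] --> 0) ->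
  exists2 z : H, z != 0 & B z = z.
Proof.
move=> not0; pose x k := iter k.*2 B u; pose a k := `|x k| ^+ 2.
have incr i j : (i <= j)%N -> `|x i - x j| ^+ 2 <= a i - a j.
  move=> ij; have := iter_increment u (j - i) i.*2.
  by rewrite -doubleD subnK.
have a_noninc : {homo a : i j / (i <= j)%N >-> j <= i}.
  by move=> i j /incr h; rewrite -subr_ge0 (le_trans _ h)// sqr_ge0.
have ca : cvgn a.
  apply: nonincreasing_is_cvgn => //; exists 0 => _ [k _ <-].
  exact: sqr_ge0.
have cx : cvgn x.
  apply: (cauchy_sqr_cvg ca) => i j ij.
  by rewrite (le_trans (incr _ _ ij))// ler_norm.
have cBx : B (B (x k)) @[k --> \oo] --> limn x.
  by have := cx; rewrite -(cvg_shiftS x).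
have cBx' : B (B (x k)) @[k --> \oo] --> B (B (limn x)).
  apply/cvgrPdist_lt => e e0; have /cvgrPdist_lt/(_ _ e0) := cx.
  apply: filterS => k; apply: le_lt_trans.
  exact: (iter_lipschitz 2).
have BBz : B (B (limn x)) = limn x.
  exact: (cvg_unique _ cBx' cBx).
have z0 : limn x != 0.
  apply/negP => /eqP z0; apply: not0.
  rewrite (_ : 0 = `|limn x| ^+ 2 :> R); last by rewrite z0 normr0 expr0n.
  under eq_fun do rewrite expr2; rewrite expr2.
  by apply: cvgM; apply: cvg_norm.
exists (limn x) => //; apply/eqP; rewrite -subr_eq0; apply/eqP.
set y := B _ - _; have By : B y = - y.
  by rewrite /y -[in LHS]scaleN1r BD BBz scaleN1r opprB.
apply: (ip_eq0 ipE); apply/eqP; rewrite eq_le (ip_ge0 ipE) andbT.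
have := B_ge0 y; rewrite By -scaleN1r ipZ mulN1r.
by rewrite oppr_ge0.
Qed.

(** An almost maximiser [v] of the quadratic form satisfies
    [|v - B v| <= de], and the displacement grows at most linearly under
    iteration; so the powers of [B] do not annihilate [v]. *)
Lemma iter_lower_bound v k (de : R) : `|v| <= 1 -> 0 <= de ->
  1 - de ^+ 2 <= ip (B v) v -> 1 - de * k.+1%:R <= `|iter k B v|.
Proof.
move=> v1 de0 hv.
have vB : `|v - B v| <= de.
  rewrite -ler_sqr ?nnegrE// (normB_sqr ipE) (ipC ip v).
  have := normB_le_form v; have : `|v| ^+ 2 <= 1 by rewrite exprn_ile1.
  lra.
have vk j : `|v - iter j B v| <= de * j%:R.
  elim: j => [|j IH]; first by rewrite subrr normr0 mulr0.
  rewrite (_ : v - _ = (v - B v) + (B v - B (iter j B v))); last first.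
    by rewrite addrA subrK.
  rewrite (le_trans (ler_normD _ _))// -addn1 natrD mulrDr mulr1 addrC lerD//.
  exact: le_trans (iter_lipschitz 1 _ _) IH.
have v_ge : 1 - de <= `|v|.
  have [d1|d1] := leP de 1; last by rewrite (le_trans _ (normr_ge0 v))// subr_le0 ltW.
  have h2 : 1 - de ^+ 2 <= `|v| ^+ 2 by apply: le_trans hv _; exact: B_le.
  have := normr_ge0 v; nra.
have := ler_distD 0 v (iter k B v); have := vk k.
have := lerB_dist v (iter k B v).
rewrite -addn1 natrD mulrDr mulr1; lra.
Qed.

End power_iteration.

(** * The top of the spectrum of a Gaussian covariance *)

Section covariance_eigenvalue.
Context (R : realType) (H : completeNormedModType R).
Variable ip : {dot H for @idfun R}.
Hypothesis ipE : forall u : H, `|u| ^+ 2 = ip u u.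
Context d (T : measurableType d) (P : probability T R).
Variables (zeta : T -> H) (A : H -> H) (M : R).
Implicit Types (u v : H) (c : R).

Hypothesis AD : forall c u v, A (u + c *: v) = A u + c *: A v.
Hypothesis Asym : forall u v, ip (A u) v = ip u (A v).
Hypothesis A_ge0 : forall u, 0 <= ip (A u) u.
Hypothesis A_le : forall u, ip (A u) u <= M * `|u| ^+ 2.
Hypothesis mzeta : forall f : H -> R, continuous f ->
  measurable_fun setT (fun w => f (zeta w)).
Hypothesis laplace : forall h, \int[P]_w expR (- (ip (zeta w) h ^+ 2 / 2))
  = (Num.sqrt (1 + ip (A h) h))^-1.

Lemma AZ c u : A (c *: u) = c *: A u.
Proof.
have A0 : A 0 = 0.
  have := AD 1 0 0; rewrite !scale1r addr0 => /eqP.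
  by rewrite -subr_eq0 opprD addrA subrr sub0r oppr_eq0 => /eqP.
by have := AD c 0 u; rewrite A0 !add0r.
Qed.

Section normalized.
Variable m : R.
Hypothesis m0 : 0 < m.
Hypothesis A_le_m : forall u, ip (A u) u <= m * `|u| ^+ 2.
Hypothesis m_adh : forall e, 0 < e ->
  exists2 v, `|v| <= 1 & m * (1 - e) <= ip (A v) v.

Let B u := m^-1 *: A u.

Let BD c u v : B (u + c *: v) = B u + c *: B v.
Proof. by rewrite /B AD scalerDr !scalerA mulrC. Qed.

Let Bsym u v : ip (B u) v = ip u (B v).
Proof. by rewrite /B ipZ ipZr Asym. Qed.

Let B_ge0 u : 0 <= ip (B u) u.
Proof. by rewrite /B ipZ mulr_ge0 ?A_ge0// invr_ge0 ltW. Qed.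

Let B_le u : ip (B u) u <= `|u| ^+ 2.
Proof. by rewrite /B ipZ ler_pdivrMl. Qed.

Let norm_iter_continuous k : continuous (fun u => `|iter k B u|).
Proof.
apply: (@lipschitz_continuous _ _ _ 1) => u v; rewrite mul1r.
apply: (le_trans (ler_dist_dist _ _)).
exact: (iter_lipschitz ipE BD Bsym B_ge0 B_le).
Qed.

(** If every orbit tended to zero, the Laplace transforms of the squared norms
    [|B ^ (2 k) zeta| ^ 2] would tend to one. They stay away from one: test
    against an almost maximiser [v] and move the power to the other side,
    where [g = B ^ (2 k) v] still has [<A g, g> >= m / 4]. *)
Lemma exists_iter_not_cvg0 :
  exists w, ~ (`|iter k.*2 B (zeta w)| ^+ 2 @[k --> \oo] --> 0).
Proof.
apply: contrapT => /forallNP not0.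
have cvg0 w : `|iter k.*2 B (zeta w)| ^+ 2 @[k --> \oo] --> 0.
  exact: contrapT (not0 w).
pose f k w := expR (- (`|iter k.*2 B (zeta w)| ^+ 2 / 2)).
have mf k : measurable_fun setT (f k).
  apply: measurableT_comp => //; apply: measurableT_comp => //.
  apply: measurable_funM => //; apply: measurable_funX.
  exact: (mzeta (@norm_iter_continuous _)).
have f01 k w : `|f k w| <= 1.
  rewrite ger0_norm ?expR_ge0// -expR0 ler_expR oppr_le0.
  by rewrite divr_ge0// sqr_ge0.
have fi k : P.-integrable setT (fun w => (f k w)%:E).
  exact: (@prob_integrable _ _ _ P _ 1).
have lim1 : (\int[P]_w (f k w)%:E)%E @[k --> \oo] --> 1%E.
  have [] := @dominated_convergence _ T _ P setT measurableT
    (fun k w => (f k w)%:E) (cst 1%E) (cst 1%E).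
  - by move=> k; exact/measurable_EFinP.
  - exact: measurable_cst.
  - apply/aeW => w _; apply: cvg_EFin; first exact: nearW.
    rewrite -[X in _ --> X](_ : expR (- (0 / 2)) = 1); last first.
      by rewrite mul0r oppr0 expR0.
    apply: (continuous_cvg _ (@continuous_expR _ _)).
    by apply: cvgN; apply: cvgM; [exact: cvg0|exact: cvg_cst].
  - exact: finite_measure_integrable_cst.
  - by apply/aeW => w k _; rewrite lee_fin.
  by rewrite (_ : (\int[P]_x cst 1%E x)%E = 1%E)// integral_prob_cst.
have bound k : \int[P]_w f k w <= (Num.sqrt (1 + m / 4))^-1.
  (* With this [de] the lower bound for the [N]-th iterate exceeds 1 / 2. *)
  pose N := (k.*2).+1; pose de : R := (2 * N.+1%:R)^-1.
  have de0 : 0 < de by rewrite invr_gt0 mulr_gt0.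
  have [v v1 hv] := m_adh (exprn_gt0 2 de0).
  have hv' : 1 - de ^+ 2 <= ip (B v) v by rewrite /B ipZ ler_pdivlMl.
  have half : 2^-1 <= `|iter N B v|.
    have := iter_lower_bound ipE BD Bsym B_ge0 B_le N v1 (ltW de0) hv'.
    by apply: le_trans; rewrite /de invfM divfK ?pnatr_eq0//; lra.
  pose g := iter k.*2 B v.
  have Ag : m / 4 <= ip (A g) g.
    have := normB_le_form ipE BD Bsym B_ge0 B_le g.
    have -> : ip (B g) g = m^-1 * ip (A g) g by rewrite /B ipZ.
    rewrite ler_pdivlMl// => h.
    apply: le_trans h; rewrite ler_wpM2l ?(ltW m0)//.
    rewrite -[iter N B v]/(B g) in half.
    rewrite (_ : 4^-1 = 2^-1 ^+ 2); last by field.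
    by rewrite ler_sqr ?nnegrE.
  apply: (@le_trans _ _ (\int[P]_w expR (- (ip (zeta w) g ^+ 2 / 2)))).
    apply: (@le_Rintegral_prob _ _ _ P _ _ 1) => //.
    - apply: measurableT_comp => //; apply: measurableT_comp => //.
      apply: measurable_funM => //; apply: measurable_funX.
      exact: (mzeta (ip_continuous ipE (v := g))).
    - move=> w; rewrite ger0_norm ?expR_ge0// -expR0 ler_expR oppr_le0.
      by rewrite divr_ge0// sqr_ge0.
    move=> w; rewrite ler_expR lerN2 ler_pM2r ?invr_gt0//.
    rewrite -(iter_sym Bsym) -ler_sqrt ?sqr_ge0// !sqrtr_sqr.
    rewrite (le_trans (ip_cauchy_schwarz ipE _ _))//.
    by rewrite normr_id ler_piMr.
  rewrite laplace lef_pV2 ?posrE ?sqrtr_gt0 ?ltr_pwDl ?A_ge0 ?divr_ge0 ?(ltW m0)//.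
  by rewrite ler_wsqrtr// lerD2l.
have : (1 <= ((Num.sqrt (1 + m / 4))^-1)%:E :> \bar R)%E.
  rewrite -(cvg_lim _ lim1)//; apply: lime_le; first by apply/cvg_ex; exists 1%E.
  apply: nearW => k.
  by rewrite -[leLHS]fineK ?lee_fin ?bound// integrable_fin_num.
rewrite lee_fin leNgt invf_lt1 ?sqrtr_gt0 ?ltr_pwDl ?divr_ge0 ?(ltW m0)//.
by rewrite -[X in X < _]sqrtr1 ltr_sqrt ?ltrDl ?divr_gt0// ltr_pwDl ?divr_ge0 ?(ltW m0).
Qed.

Lemma normalized_eigenvector : exists2 z, z != 0 & A z = m *: z.
Proof.
have [w hw] := exists_iter_not_cvg0.
have [z z0 Bz] := power_iteration_fixpoint ipE BD Bsym B_ge0 B_le hw.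
by exists z => //; rewrite -[in RHS]Bz /B scalerA divff ?scale1r ?gt_eqF.
Qed.

End normalized.

(** The supremum of the quadratic form of a Gaussian covariance is an
    eigenvalue: the almost sure finiteness of the Gaussian variable plays the
    part of compactness. *)
Lemma covariance_eigenvector : (exists u, 0 < ip (A u) u) ->
  exists m : R, [/\ 0 < m, (forall u, ip (A u) u <= m * `|u| ^+ 2) &
    exists2 z, z != 0 & A z = m *: z].
Proof.
move=> [u0 hu0].
pose S := [set ip (A u) u | u in [set u | `|u| <= 1]].
have u01 : 0 < `|u0|.
  rewrite normr_gt0; apply/negP => /eqP u0E.
  by move: hu0; rewrite u0E ip0r ltxx.
have unit u : `|u| != 0 -> S (`|u| ^- 2 * ip (A u) u).
  move=> un0; exists (`|u|^-1 *: u); first by rewrite /= normrZ ger0_norm ?mulVf.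
  by rewrite AZ ipZ ipZr mulrA -expr2 exprVn.
have hS : has_sup S.
  split; first by exists (`|u0| ^- 2 * ip (A u0) u0); apply: unit; rewrite gt_eqF.
  exists `|M| => _ [u /= u1 <-]; apply: (le_trans (A_le u)).
  apply: (@le_trans _ _ (`|M| * `|u| ^+ 2)).
    by rewrite ler_wpM2r ?sqr_ge0// ler_norm.
  by rewrite ler_piMr// exprn_ile1.
have ubS u : `|u| != 0 -> `|u| ^- 2 * ip (A u) u <= sup S.
  by move=> un0; apply: (sup_upper_bound hS); exact: unit.
have m0 : 0 < sup S.
  apply: (@lt_le_trans _ _ (`|u0| ^- 2 * ip (A u0) u0)).
    by rewrite mulr_gt0// invr_gt0 exprn_gt0.
  by apply: ubS; rewrite gt_eqF.
have le_m u : ip (A u) u <= sup S * `|u| ^+ 2.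
  have [un0|un0] := eqVneq `|u| 0.
    have -> : u = 0 by apply/eqP; rewrite -normr_eq0 un0.
    by rewrite ip0r normr0 expr0n mulr0.
  rewrite mulrC -ler_pdivrMl; first exact: ubS.
  by rewrite exprn_gt0// lt_neqAle eq_sym un0 normr_ge0.
have adh e : 0 < e -> exists2 v, `|v| <= 1 & sup S * (1 - e) <= ip (A v) v.
  move=> e0; have [_ [v v1 <-] hv] := sup_adherent (mulr_gt0 m0 e0) hS.
  by exists v => //; rewrite mulrBr mulr1 ltW.
exists (sup S); split => //; exact: normalized_eigenvector.
Qed.

End covariance_eigenvalue.

(** * Orthonormal systems of eigenvectors *)

Section finite_dimension.
Context (R : realType) (H : completeNormedModType R).
Variable ip : {dot H for @idfun R}.
Hypothesis ipE : forall u : H, `|u| ^+ 2 = ip u u.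
Implicit Types (u v : H) (vs : seq H).

Lemma ip_suml n (c : 'I_n -> R) (x : 'I_n -> H) v :
  ip (\sum_i c i *: x i) v = \sum_i c i * ip (x i) v.
Proof.
rewrite (big_morph (fun u => ip u v) (id1 := 0) (op1 := +%R) _ (ip0l ip v)).
  by apply: eq_bigr => i _; rewrite (ipZ ip).
by move=> u w; rewrite linearDl.
Qed.

Lemma kermx_neq0 m n (C : 'M[R]_(m, n)) : (n < m)%N ->
  exists2 c : 'rV[R]_m, c != 0 & c *m C = 0.
Proof.
move=> nm; have : kermx C != 0.
  by rewrite -mxrank_eq0 mxrank_ker subn_eq0 -ltnNge (leq_ltn_trans (rank_leq_col C)).
by move=> /rowV0Pn[c /sub_kermxP cC c0]; exists c.
Qed.

(** The orthogonality conditions are fewer than the dimensions. *)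
Lemma dim_gt_orthogonal (E : set H) m vs : has_dim E m -> (size vs < m)%N ->
  exists u, [/\ E u, u != 0 & forall v, v \in vs -> ip u v = 0].
Proof.
move=> [x [xfree ->]] vsm.
have [c c0 cM] := kermx_neq0 (\matrix_(i < m, l < size vs) ip (x i) vs`_l) vsm.
exists (\sum_i c ord0 i *: x i); split; first by exists (c ord0).
- apply/negP => /eqP /xfree c0'; move/negP: c0; apply; apply/eqP/rowP => i.
  by rewrite c0' mxE.
- move=> v /(nthP 0)[l lvs <-].
  have := congr1 (fun M : 'rV[R]__ => M ord0 (Ordinal lvs)) cM.
  rewrite !mxE ip_suml => h; rewrite -[RHS]h; apply: eq_bigr => i _.
  by rewrite mxE.
Qed.

Lemma orthonormal_le_dim (E : set H) m k (v : 'I_k -> H) : has_dim E m ->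
  (forall l, E (v l)) -> (forall i j, ip (v i) (v j) = (i == j)%:R) -> (k <= m)%N.
Proof.
move=> [x [_ ->]] Ev on; rewrite leqNgt; apply/negP => mk.
have /choice[c hc] : forall l, exists c : 'I_m -> R, \sum_i c i *: x i = v l.
  by move=> l; have [c _ <-] := Ev l; exists c.
have [g g0 gC] := kermx_neq0 (\matrix_(l < k, i < m) c l i) mk.
move/negP: g0; apply; apply/eqP/rowP => j; rewrite mxE.
have sum0 : \sum_l g ord0 l *: v l = 0.
  under eq_bigr => l _ do rewrite -hc scaler_sumr.
  rewrite exchange_big/= big1// => i _.
  under eq_bigr do rewrite scalerA.
  rewrite -scaler_suml; have := congr1 (fun M : 'rV[R]__ => M ord0 i) gC.
  rewrite !mxE => h; rewrite [X in X *: _](_ : _ = 0) ?scale0r// -[RHS]h.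
  by apply: eq_bigr => l _; rewrite mxE.
have := congr1 (fun z => ip z (v j)) sum0; rewrite ip0l ip_suml => <-.
rewrite (bigD1 j)//= on eqxx mulr1 big1 ?addr0// => i ij.
by rewrite on (negbTE ij) mulr0.
Qed.

End finite_dimension.

Lemma card_eq_enum (S : set nat) n : (S #= `I_n)%card ->
  exists t : seq nat, [/\ uniq t, size t = n & forall j, (j \in t) = (j \in S)].
Proof.
move=> Sn; have finS : finite_set S by apply/finite_setP; exists n.
exists (fset_set S); split; first exact: fset_uniq.
- exact: card_fset_set.
- exact: in_fset_set.
Qed.

Section eigenvectors.
Context (R : realType) (H : completeNormedModType R).
Variable ip : {dot H for @idfun R}.
Hypothesis ipE : forall u : H, `|u| ^+ 2 = ip u u.
Variables (Sigma : {linear H -> H}) (lam : R^nat).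
Hypothesis Sym : forall u v, ip (Sigma u) v = ip u (Sigma v).
Hypothesis hlam : eigenvalue_sequence Sigma lam.
Implicit Types (u v : H).

Let next (s : seq H) : H :=
  if lam (size s) == 0 then 0
  else xget 0 [set u | [/\ Sigma u = lam (size s) *: u, ip u u = 1 &
    forall v, v \in s -> ip u v = 0]].

Let prefix : nat -> seq H :=
  fix prefix n := if n is n'.+1 then rcons (prefix n') (next (prefix n')) else [::].

Let e n := next (prefix n).

Let prefixE n : prefix n = mkseq e n.
Proof. by elim: n => [//|n IH]; rewrite mkseqS -IH. Qed.

Let size_prefix n : size (prefix n) = n.
Proof. by rewrite prefixE size_mkseq. Qed.

Let good n := if lam n == 0 then e n = 0 else
  [/\ Sigma (e n) = lam n *: e n, ip (e n) (e n) = 1 &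
    forall j, (j < n)%N -> ip (e n) (e j) = 0].

Lemma eigenvectors_orthogonal (a c : R) u v : a != c ->
  Sigma u = a *: u -> Sigma v = c *: v -> ip u v = 0.
Proof.
move=> ac ua vc; have := Sym u v; rewrite ua vc ipZ (ipZr ip) => /eqP.
by rewrite -subr_eq0 -mulrBl mulf_eq0 subr_eq0 (negbTE ac) => /eqP.
Qed.

(** A new unit eigenvector exists at every step: the earlier vectors for the same
    eigenvalue are fewer than the dimension of its eigenspace, and those for
    other eigenvalues are orthogonal to it anyway. *)
Let goodP n : good n.
Proof.
have [k] := ubnP n; elim: k n => // k IH n; rewrite ltnS => nk.
rewrite /good; case: ifPn => [l0|l0]; first by rewrite /e /next size_prefix l0.
have {}IH j : (j < n)%N -> good j by move=> jn; apply: IH; exact: leq_trans nk.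
suff [u [Su u1 uo]] : exists u, [/\ Sigma u = lam n *: u, ip u u = 1 &
    forall v, v \in prefix n -> ip u v = 0].
  have : [set u | [/\ Sigma u = lam (size (prefix n)) *: u, ip u u = 1 &
      forall v, v \in prefix n -> ip u v = 0]] (e n).
    rewrite /e /next size_prefix (negbTE l0); apply: xgetPex.
    by exists u; split.
  rewrite /= size_prefix => -[h1 h2 h3]; split => // j jn.
  by apply: h3; rewrite prefixE map_f// mem_iota.
have [m cardm dimm] := hlam.2 _ l0.
have [t [ut st tS]] := card_eq_enum cardm.
pose js := [seq j <- iota 0 n | lam j == lam n].
have js_m : (size [seq e j | j <- js] < m)%N.
  rewrite size_map -st -[X in (X <= _)%N]/(size (n :: js)); apply: uniq_leq_size.
    by rewrite /= mem_filter mem_iota add0n ltnn !andbF filter_uniq ?iota_uniq.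
  move=> j; rewrite inE tS => /predU1P[->|]; first exact/mem_set.
  by rewrite mem_filter => /andP[/eqP jn _]; exact/mem_set.
have [u [Eu u0 uo]] := dim_gt_orthogonal ip dimm js_m.
have nu : ip u u != 0 by apply/negP => /eqP /(ip_eq0 ipE) /eqP; exact/negP.
pose c := (Num.sqrt (ip u u))^-1.
have c2 : c * (c * ip u u) = 1.
  by rewrite mulrA -expr2 exprVn sqr_sqrtr ?(ip_ge0 ipE)// mulVf.
exists (c *: u); split.
- by rewrite linearZ/= Eu !scalerA mulrC.
- by rewrite ipZ (ipZr ip).
- move=> v; rewrite prefixE => /mapP[j]; rewrite mem_iota/= => jn ->.
  rewrite ipZ; have [ln|ln] := eqVneq (lam j) (lam n).
    rewrite uo ?mulr0// map_f// mem_filter ln eqxx/=.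
    by rewrite mem_iota.
  have := IH _ jn; rewrite /good; case: ifPn => [_ ->|_ [ej _ _]].
    by rewrite (ip0r ip) mulr0.
  by rewrite (eigenvectors_orthogonal _ Eu ej) ?mulr0// eq_sym.
Qed.

(** The vectors chosen for a nonzero eigenvalue are as many as the dimension of
    its eigenspace, so that no further vector is orthogonal to all of them. The
    vectors at indices with [lam j = 0] are zero. *)
Lemma eigenvector_system : exists e : nat -> H, [/\
  (forall j, Sigma (e j) = lam j *: e j),
  (forall j, ip (e j) (e j) = (lam j != 0)%:R),
  (forall i j, i != j -> ip (e i) (e j) = 0) &
  (forall (a : R) u, a != 0 -> Sigma u = a *: u ->
    (forall j, ip u (e j) = 0) -> u = 0)].
Proof.
have eE j : Sigma (e j) = lam j *: e j.
  have := goodP j; rewrite /good; case: ifPn => [_ ->|_ [->]//].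
  by rewrite linear0 scaler0.
have e1 j : ip (e j) (e j) = (lam j != 0)%:R.
  have := goodP j; rewrite /good; case: ifPn => [_ ->|_ [_ ->]//].
  by rewrite (ip0l ip).
have lt i j : (i < j)%N -> ip (e j) (e i) = 0.
  have := goodP j; rewrite /good; case: ifPn => [_ -> _|_ [_ _ h /h]//].
  by rewrite (ip0l ip).
have eo i j : i != j -> ip (e i) (e j) = 0.
  by case: ltngtP => // ij _; [rewrite ipC|]; exact: lt.
exists e; split => // a u a0 ua uo; apply: contrapT => /eqP u0.
have [m cardm dimm] := hlam.2 _ a0.
have [t [ut st tS]] := card_eq_enum cardm.
have nu : ip u u != 0 by apply/negP => /eqP /(ip_eq0 ipE) /eqP; exact/negP.
pose c := (Num.sqrt (ip u u))^-1.
have c2 : c * (c * ip u u) = 1.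
  by rewrite mulrA -expr2 exprVn sqr_sqrtr ?(ip_ge0 ipE)// mulVf.
pose v (l : 'I_m.+1) : H :=
  if unlift ord0 l is Some i then e (nth 0%N t i) else c *: u.
have ta (i : 'I_m) : lam (nth 0%N t i) = a.
  have : nth 0%N t i \in t by rewrite mem_nth// st.
  by rewrite tS => /set_mem.
have Ev l : eigen_subspace Sigma a (v l).
  rewrite /v /eigen_subspace/=; case: unliftP => [i _|_].
    by rewrite eE ta.
  by rewrite linearZ/= ua !scalerA mulrC.
have on i j : ip (v i) (v j) = (i == j)%:R.
  rewrite /v; case: (unliftP ord0 i) => [i' ->|->];
    case: (unliftP ord0 j) => [j' ->|->].
  - rewrite (inj_eq lift_inj); have [->|ij] := eqVneq i' j'.
      by rewrite e1 ta a0.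
    rewrite eo// nth_uniq ?st//.
  - by rewrite (ipZr ip) ipC uo mulr0 eq_sym (negbTE (neq_lift _ _)).
  - by rewrite ipZ uo mulr0 (negbTE (neq_lift _ _)).
  - by rewrite ipZ (ipZr ip) c2 eqxx.
by have := orthonormal_le_dim dimm Ev on; rewrite ltnn.
Qed.

End eigenvectors.

(** * Residuals of an orthogonal expansion *)

Section residual.
Context (R : realType) (H : completeNormedModType R).
Variable ip : {dot H for @idfun R}.
Hypothesis ipE : forall u : H, `|u| ^+ 2 = ip u u.
Variables (e : nat -> H) (nz : nat -> bool).
Hypothesis e_norm : forall j, ip (e j) (e j) = (nz j)%:R.
Hypothesis e_orth : forall i j, i != j -> ip (e i) (e j) = 0.
Implicit Types (u v : H) (n i j : nat).

Fixpoint residual n u : H :=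
  if n is n'.+1 then residual n' u - ip u (e n') *: e n' else u.

Definition energy n u : R := \sum_(0 <= j < n) ip u (e j) ^+ 2.

Lemma ip_e_nz u j : ip u (e j) * (nz j)%:R = ip u (e j).
Proof.
have := e_norm j; case: (nz j) => /=; first by rewrite mulr1.
by move=> /(ip_eq0 ipE) ->; rewrite (ip0r ip) mulr0.
Qed.

Lemma residual_ip n u j :
  ip (residual n u) (e j) = if (j < n)%N then 0 else ip u (e j).
Proof.
elim: n => [//|n IH] /=; rewrite ipB IH ipZ ltnS.
have [->|jn] := eqVneq j n.
  by rewrite ltnn leqnn e_norm ip_e_nz subrr.
rewrite e_orth 1?eq_sym// mulr0 subr0.
by rewrite (leq_eqVlt j n) (negbTE jn).
Qed.

Lemma residual_norm n u : `|residual n u| ^+ 2 = `|u| ^+ 2 - energy n u.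
Proof.
elim: n => [|n IH] /=; first by rewrite /energy big_geq// subr0.
rewrite (normB_sqr ipE) IH (ipZr ip) residual_ip ltnn.
rewrite [X in _ + X]ipE (ipZ ip) (ipZr ip) e_norm ip_e_nz.
by rewrite /energy big_nat_recr//=; ring.
Qed.

Lemma energy_le n u : energy n u <= `|u| ^+ 2.
Proof. by rewrite -subr_ge0 -residual_norm sqr_ge0. Qed.

Lemma energy_nondecreasing u :
  {homo (fun n => energy n u) : i j / (i <= j)%N >-> i <= j}.
Proof.
apply/nondecreasing_seqP => n.
by rewrite /energy big_nat_recr//= lerDl sqr_ge0.
Qed.

Lemma energy_is_cvg u : cvgn (fun n => energy n u).
Proof.
apply: nondecreasing_is_cvgn; first exact: energy_nondecreasing.
by exists (`|u| ^+ 2) => _ [n _ <-]; exact: energy_le.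
Qed.

Lemma residual_ip_residual i j u v : (i <= j)%N ->
  ip (residual i u) (residual j v) = ip u (residual j v).
Proof.
elim: i => [//|i IH] ij /=; rewrite ipB ipZ IH 1?ltnW//.
by rewrite [ip (e i) _]ipC residual_ip ij mulr0 subr0.
Qed.

Lemma residual_sym n u v : ip (residual n u) v = ip u (residual n v).
Proof.
rewrite -(residual_ip_residual _ _ (leqnn n)).
by rewrite [RHS]ipC residual_ip_residual// ipC.
Qed.

Lemma residualD n c u v : residual n (u + c *: v) = residual n u + c *: residual n v.
Proof.
elim: n => [//|n IH] /=; rewrite IH ipD scalerDl scalerBr scalerA.
by rewrite opprD addrACA.
Qed.

Lemma residual_le n u : `|residual n u| <= `|u|.
Proof.
rewrite -ler_sqr ?nnegrE// residual_norm lerBlDr lerDl.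
by apply: sumr_ge0 => j _; exact: sqr_ge0.
Qed.

Lemma residual_increment i j u : (i <= j)%N ->
  `|residual i u - residual j u| ^+ 2 = energy j u - energy i u.
Proof.
move=> ij; have ru : ip u (residual j u) = `|residual j u| ^+ 2.
  by rewrite ipE residual_ip_residual.
by rewrite (normB_sqr ipE) residual_ip_residual// ru !residual_norm; ring.
Qed.

(** The increments of the residuals are those of the energy, which is bounded
    and monotone. *)
Lemma residual_is_cvg u : cvgn (residual ^~ u).
Proof.
have increment i j : (i <= j)%N ->
    `|residual i u - residual j u| ^+ 2 <= `|energy i u - energy j u|.
  by move=> ij; rewrite residual_increment// distrC ler_norm.
exact: (cauchy_sqr_cvg (@energy_is_cvg u) increment).
Qed.

Lemma residual_continuous n : continuous (residual n).
Proof.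
move=> u; apply/cvgrPdist_lt => /= t t0; near=> v.
have -> : residual n u - residual n v = residual n (u - v).
  by rewrite -[in RHS]scaleN1r residualD scaleN1r.
apply: le_lt_trans (residual_le _ _) _; near: v.
by apply: cvgr_dist_lt.
Unshelve. all: by end_near. Qed.

(** What the energy lacks of the squared norm is the squared norm of the
    residual. *)
Lemma energy_cvg u : limn (residual ^~ u) = 0 ->
  energy n u @[n --> \oo] --> `|u| ^+ 2.
Proof.
move=> lim0; have := @residual_is_cvg u; rewrite lim0 => c0.
have : `|residual n u| ^+ 2 @[n --> \oo] --> (0 : R).
  rewrite -[X in _ --> X](_ : `|0 : H| * `|0 : H| = 0); last by rewrite normr0 mulr0.
  under eq_fun do rewrite expr2.
  by apply: cvgM; apply: cvg_norm.
move=> h; rewrite -[X in _ --> X]subr0.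
rewrite (_ : (fun n => energy n u) = (fun n => `|u| ^+ 2 - `|residual n u| ^+ 2)).
  by apply: cvgB => //; exact: cvg_cst.
by apply/funext => n; rewrite residual_norm; ring.
Qed.

End residual.

(** * One-dimensional marginals of a Gaussian element *)

Section gaussian_covariance.
Context d (T : measurableType d) (R : realType) (P : probability T R).
Variable (H : completeNormedModType R) (ip : {dot H for @idfun R}).
Variables (xi : T -> H) (Sigma : {linear H -> H}).
Hypothesis ipE : forall u : H, `|u| ^+ 2 = ip u u.
Hypothesis hgauss : gaussian_element P ip xi.
Hypothesis hmean : zero_mean P ip xi.
Hypothesis hcov : covariance_operator P ip xi Sigma.

Lemma measurable_comp_element (f : H -> R) : continuous f ->
  measurable_fun setT (fun w => f (xi w)).
Proof.
move=> cf; apply: (measurability _ (RGenOInfty.measurableE R)) => _ [_ [a ->] <-].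
rewrite (_ : _ @^-1` _ = xi @^-1` (f @^-1` `]a, +oo[%classic)); last by [].
apply: (hgauss.1) => //; apply: sub_sigma_algebra.
apply: open_comp; first by move=> u _; exact: cf.
exact: interval_open.
Qed.

Let X h w := ip (xi w) h.

Lemma measurable_coordinate h : measurable_fun setT (X h).
Proof. exact: (measurable_comp_element (ip_continuous ipE (v := h))). Qed.

Lemma integral_gauss_affine (m s : R) :
  (\int[gauss R]_z (m + s * z)%:E = m%:E)%E.
Proof.
have i1 : (gauss R).-integrable setT (fun z => (s * z)%:E).
  by apply: integrable_mulrl; exact: gauss_integrable_id.
rewrite -[LHS]fineK; last first.
  apply: integrable_fin_num => //; under eq_fun do rewrite EFinD.
  by apply: integrableD => //; exact: finite_measure_integrable_cst.
congr EFin; rewrite -[LHS]/(Rintegral _ _ _) RintegralD//; last first.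
  exact: (finite_measure_integrable_cst (gauss R) m measurableT).
rewrite Rintegral_prob_cst RintegralZl//; last exact: gauss_integrable_id.
by rewrite Rintegral_gauss_id mulr0 addr0.
Qed.

Lemma integral_gauss_sqr (s : R) :
  (\int[gauss R]_z ((s * z) * (s * z))%:E = (s ^+ 2)%:E)%E.
Proof.
under eq_integral do rewrite -expr2 exprMn EFinM.
have z2 : (\int[gauss R]_z (z ^+ 2)%:E = 1%E)%E.
  rewrite -[LHS]fineK; first by rewrite -[fine _]/(Rintegral _ _ _) Rintegral_gauss_sqr.
  apply: integrable_fin_num => //.
  apply: (@gauss_integrable _ (fun z => z ^+ 2) 1 2); first exact: measurable_funX.
  move=> z; rewrite mul1r normrX expRM_natl ler_pXn2r ?nnegrE ?expR_ge0//.
  exact: le_expR.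
rewrite ge0_integralZl ?z2 ?mule1//.
- by apply/measurable_EFinP; exact: measurable_funX.
- by move=> z _; rewrite lee_fin sqr_ge0.
- by rewrite lee_fin sqr_ge0.
Qed.

(** The mean and the variance of the normal law given for [<xi, h>] are
    identified from the vanishing mean and the covariance operator. *)
Lemma gaussian_law_coordinate h (A : set (measurableTypeR R)) : measurable A ->
  P (X h @^-1` A) =
  gauss R ((fun z => Num.sqrt (ip (Sigma h) h) * z) @^-1` A).
Proof.
have [m [s law]] := hgauss.2 h.
have same (B : set (measurableTypeR R)) : measurable B ->
    P (X h @^-1` B) = gauss R ((fun z => m + s * z) @^-1` B).
  by move=> mB; rewrite -gaussian_lawE//; exact: law.
have tr := integral_same_law (measurable_coordinate h) (measurable_affine m s) same.
have EX : ('E_P[X h] = 0)%E := hmean h.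
have m0 : m = 0.
  move: EX; rewrite unlock (tr EFin).
    by rewrite integral_gauss_affine => -[].
  exact/measurable_EFinP.
have s2 : s ^+ 2 = ip (Sigma h) h.
  have := hcov.2 h h; rewrite -[fun w => ip (xi w) h]/(X h) unlock EX /=.
  rewrite unlock => hc; apply: EFin_inj; rewrite -[RHS]hc -integral_gauss_sqr.
  transitivity (\int[P]_w (X h w * X h w)%:E)%E.
    rewrite (tr (fun x => (x * x)%:E)).
      by apply: eq_integral => z _; rewrite m0 add0r.
    by apply/measurable_EFinP; exact: measurable_funM.
  apply: eq_integral => w _; congr EFin; rewrite -[RHS]/((X h w - 0) * (X h w - 0)).
  by rewrite subr0.
move=> mA; rewrite (same _ mA) -(gaussian_lawE m s mA) m0.
rewrite -[fun z => _](_ : (fun z => 0 + Num.sqrt (ip (Sigma h) h) * z) = _); last first.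
  by apply/funext => z; rewrite add0r.
rewrite -(gaussian_lawE 0 _ mA) -s2 sqrtr_sqr /gaussian_law normr_eq0.
case: ifPn => [_|s0]; first exact: erefl.
apply: eq_integral => x _.
rewrite !normal_pdfE ?normr_eq0// /normal_peak /normal_fun.
by rewrite real_normK ?num_real.
Qed.

Lemma covariance_sym u v : ip (Sigma u) v = ip u (Sigma v).
Proof.
apply: EFin_inj; rewrite -hcov.2 covarianceC hcov.2.
by rewrite [in RHS]ipC.
Qed.

Lemma covariance_ge0 u : 0 <= ip (Sigma u) u.
Proof.
rewrite -lee_fin -hcov.2; exact: variance_ge0.
Qed.

Lemma covariance_bounded : exists2 M : R, 0 <= M &
  forall u, ip (Sigma u) u <= M * `|u| ^+ 2.
Proof.
have [cS _] := hcov; have := (linear_bounded_continuous Sigma).2 cS.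
move=> /linear_boundedP /pinfty_ex_gt0[M M0 hM].
exists M; first exact: ltW.
move=> u; rewrite (le_trans (ler_norm _))//.
rewrite (le_trans (ip_cauchy_schwarz ipE _ _))//.
by rewrite expr2 mulrA ler_wpM2r.
Qed.

End gaussian_covariance.

(** * Passage to the limit *)

Lemma dense_approx (R : realType) (H : normedModType R) (D : set H) :
  dense D -> forall u : H, forall r : R, 0 < r -> exists2 v, D v & `|u - v| < r.
Proof.
move=> dD u r r0; have [] := dD (ball u r).
- by exists u; exact: ballxx.
- exact: ball_open.
by move=> v [+ Dv]; rewrite -ball_normE /= => uv; exists v.
Qed.

(** Inside the event for [L], the events [lo < S n] increase to almost all of
    it, and they lie in the event for [S n] because [S n <= L < hi]. *)
Lemma prob_oo_limit_le d (T : measurableType d) (R : realType)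
    (P : probability T R) (S : nat -> T -> R) (L : T -> R) (lo hi : R) (K : \bar R) :
  (forall n, measurable_fun setT (S n)) -> measurable_fun setT L ->
  (forall w, {homo (fun n => S n w) : i j / (i <= j)%N >-> i <= j}) ->
  (forall n w, S n w <= L w) ->
  {ae P, forall w, S n w @[n --> \oo] --> L w} ->
  (\forall n \near \oo, P [set w | (lo < S n w < hi)%R] <= K)%E ->
  (P [set w | (lo < L w < hi)%R] <= K)%E.
Proof.
move=> mS mL Sle SL [N [mN PN sN]] hK.
have moo (f : T -> R) : measurable_fun setT f -> measurable [set w | lo < f w < hi].
  move=> mf; rewrite -[X in measurable X]setTI.
  rewrite (_ : [set w | _] = f @^-1` `]lo, hi[%classic).
    exact: (mf measurableT).
  by apply/seteqP; split => w /=; rewrite in_itv.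
pose A n := [set w | lo < L w < hi] `&` [set w | lo < S n w].
have mA n : measurable (A n).
  apply: measurableI; first exact: moo.
  rewrite -[X in measurable X]setTI.
  rewrite (_ : [set w | _] = S n @^-1` `]lo, +oo[%classic).
    exact: (mS n measurableT).
  by apply/seteqP; split => w /=; rewrite in_itv/= andbT.
have mU : measurable (\bigcup_n A n) by exact: bigcupT_measurable.
have homoA : {homo A : n m / (n <= m)%N >-> (n <= m)%O}.
  move=> n m nm; rewrite subsetEset => w [? /= h]; split => //=.
  exact: lt_le_trans (Sle w _ _ nm).
have cA := @nondecreasing_cvg_mu _ _ _ P A mA mU homoA.
have AK : (P (\bigcup_n A n) <= K)%E.
  apply: (cvge_le _ cA); apply: filterS hK => n hn /=.
  apply: le_trans hn; apply: le_measure; [exact/mem_set/mA|exact/mem_set/moo|].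
  move=> w [/= /andP[_ Lw] Sw] /=; rewrite Sw /=.
  exact: le_lt_trans (SL n w) Lw.
have sub : [set w | lo < L w < hi] `<=` (\bigcup_n A n) `|` N.
  move=> w /= /andP[lw wh]; have [c|nc] := pselect (S n w @[n --> \oo] --> L w); last first.
    by right; exact: sN.
  left; have [n _ hn] := cvgr_gt (L w) c _ lw.
  by exists n => //; split => /=; [rewrite lw|exact: hn (leqnn n)].
apply: le_trans AK; rewrite -[leRHS]adde0 -PN.
apply: le_trans (measureU2 _ mU mN).
by apply: le_measure; [exact/mem_set/moo|exact/mem_set/measurableU|].
Qed.

Section tail_product.
Context (R : realType) (lam : R^nat) (l : R).
Hypothesis lam_noninc : nonincreasing_seq lam.
Hypothesis lam_ge0 : forall j, 0 <= lam j.
Hypothesis lam_sum : exists K : R, forall n, \sum_(0 <= j < n) lam j <= K.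
Hypothesis lam0l : lam 0%N < l.

Let l_gt0 : 0 < l.
Proof. exact: le_lt_trans (lam_ge0 0%N) lam0l. Qed.

Let lam_lt j : lam j < l.
Proof. exact: le_lt_trans (lam_noninc (leq0n j)) lam0l. Qed.

Let factor_gt0 j : 0 < 1 - lam j / l.
Proof. by rewrite subr_gt0 ltr_pdivrMr// mul1r. Qed.

Lemma tail_prod_factorE j : (1 - lam j / l) `^ (- 2^-1) = (Num.sqrt (1 - lam j / l))^-1.
Proof. by rewrite powRN powR12_sqrt// ltW. Qed.

Lemma tail_prod_factor_ge1 j : 1 <= (Num.sqrt (1 - lam j / l))^-1.
Proof.
rewrite invf_ge1 ?sqrtr_gt0// -[leRHS]sqrtr1 ler_wsqrtr// gerBl.
by rewrite divr_ge0// ltW.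
Qed.

Lemma tail_prod_ge1 n : 1 <= tail_prod lam l n.
Proof.
rewrite /tail_prod big_nat_cond; apply: (big_ind (fun x => 1 <= x)) => // [x y x1 y1|j _].
  by rewrite -[1]mulr1 ler_pM.
by rewrite tail_prod_factorE; exact: tail_prod_factor_ge1.
Qed.

Lemma tail_prod_nondecreasing : {homo tail_prod lam l : n m / (n <= m)%N >-> n <= m}.
Proof.
apply/nondecreasing_seqP => n; have [n2|n2] := leqP 2 n.
  rewrite [leRHS]/tail_prod big_nat_recr//= ler_peMr//.
    exact: le_trans (tail_prod_ge1 n).
  by rewrite tail_prod_factorE; exact: tail_prod_factor_ge1.
rewrite [leLHS]/tail_prod big_geq ?(ltnW n2)//; exact: tail_prod_ge1.
Qed.

(** With [y = 1 - lam j / l], which is positive and at most one, one has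
    [y ^ (- 1 / 2) <= 1 / y = 1 + lam j / (l - lam j)]; so convergence of the
    product reduces to summability of the eigenvalues. *)
Lemma tail_prod_factor_le j :
  (Num.sqrt (1 - lam j / l))^-1 <= expR (lam j / (l - lam 0%N)).
Proof.
have d0 : 0 < l - lam 0%N by rewrite subr_gt0.
have y0 : 0 <= lam j / l by rewrite divr_ge0// ltW.
apply: (@le_trans _ _ (1 + lam j / (l - lam 0%N))); last exact: expR_ge1Dx.
apply: (@le_trans _ _ (1 - lam j / l)^-1).
  rewrite lef_pV2 ?posrE ?sqrtr_gt0//.
  set y := 1 - _; have y1 : y <= 1 by rewrite gerBl.
  have yp : 0 < y by exact: factor_gt0.
  rewrite -[leLHS]sqr_sqrtr ?(ltW yp)// expr2 -[leRHS]mulr1 ler_wpM2l ?sqrtr_ge0//.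
  by rewrite -[leRHS]sqrtr1 ler_wsqrtr.
have lj : 0 < l - lam j by rewrite subr_gt0.
have -> : (1 - lam j / l)^-1 = 1 + lam j / (l - lam j).
  by field; rewrite !gt_eqF.
rewrite lerD2l ler_wpM2l// lef_pV2 ?posrE// lerB//.
exact: lam_noninc.
Qed.

Lemma tail_prod_is_cvg : cvgn (tail_prod lam l).
Proof.
apply: nondecreasing_is_cvgn; first exact: tail_prod_nondecreasing.
have [K hK] := lam_sum; have d0 : 0 < l - lam 0%N by rewrite subr_gt0.
exists (expR (K / (l - lam 0%N))) => _ [n _ <-].
apply: (@le_trans _ _ (\prod_(2 <= j < n) expR (lam j / (l - lam 0%N)))).
  apply: ler_prod => j _; rewrite tail_prod_factorE tail_prod_factor_le andbT.
  by rewrite invr_ge0 sqrtr_ge0.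
rewrite -expR_sum ler_expR -mulr_suml ler_wpM2r ?invr_ge0 ?(ltW d0)//.
apply: le_trans (hK n); have [n2|n2] := leqP 2 n.
  rewrite (big_cat_nat (leq0n 2))//= lerDr; exact: sumr_ge0.
by rewrite big_geq ?(ltnW n2)//; exact: sumr_ge0.
Qed.

Lemma tail_prod_le_limn n : tail_prod lam l n <= limn (tail_prod lam l).
Proof.
exact: nondecreasing_cvgn_le tail_prod_nondecreasing (@tail_prod_is_cvg) n.
Qed.

Lemma limn_tail_prod_gt0 : 0 < limn (tail_prod lam l).
Proof. exact: lt_le_trans ltr01 (le_trans (tail_prod_ge1 0) (tail_prod_le_limn 0)). Qed.

End tail_product.

(** * The spectral expansion of a Gaussian element *)

Section spectrum.
Context d (T : measurableType d) (R : realType) (P : probability T R).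
Variable (H : completeNormedModType R) (ip : {dot H for @idfun R}).
Variables (xi : T -> H) (Sigma : {linear H -> H}) (lam : R^nat).
Hypothesis ipE : forall u : H, `|u| ^+ 2 = ip u u.
Hypothesis hgauss : gaussian_element P ip xi.
Hypothesis hmean : zero_mean P ip xi.
Hypothesis hcov : covariance_operator P ip xi Sigma.
Hypothesis lam_noninc : nonincreasing_seq lam.
Variable e : nat -> H.
Hypothesis e_eigen : forall j, Sigma (e j) = lam j *: e j.
Hypothesis e_norm : forall j, ip (e j) (e j) = (lam j != 0)%:R.
Hypothesis e_orth : forall i j, i != j -> ip (e i) (e j) = 0.
Hypothesis e_exhaust : forall (a : R) u, a != 0 -> Sigma u = a *: u ->
  (forall j, ip u (e j) = 0) -> u = 0.
Implicit Types (u v : H) (n i j : nat).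

Let X h w := ip (xi w) h.
Let b u v := ip (Sigma u) v.

Let mX h : measurable_fun setT (X h).
Proof. exact: (measurable_coordinate ipE hgauss). Qed.

Let XD (c : R) h k w : X (h + c *: k) w = X h w + c * X k w.
Proof. exact: ipDr. Qed.

Let bC h k : b h k = b k h.
Proof. by rewrite /b (covariance_sym hcov) ipC. Qed.

Let bD (c : R) h k l : b (h + c *: k) l = b h l + c * b k l.
Proof. by rewrite /b linearD linearZ/= ipD. Qed.

Let b_ge0 h : 0 <= b h h.
Proof. exact: (covariance_ge0 hcov). Qed.

Let lawX h (A : set (measurableTypeR R)) : measurable A ->
  P (X h @^-1` A) = gauss R ((fun z => Num.sqrt (b h h) * z) @^-1` A).
Proof. exact: (gaussian_law_coordinate ipE hgauss hmean hcov). Qed.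

Lemma eigen_form j : b (e j) (e j) = lam j.
Proof.
rewrite /b e_eigen ipZ e_norm.
by case: eqP => [->|_]; rewrite ?mul0r ?mulr1.
Qed.

Lemma eigenvalue_ge0 j : 0 <= lam j.
Proof. by rewrite -eigen_form. Qed.

Lemma eigenvectors_b_orth k n : pairwise (fun u v => b u v == 0) (map e (iota k n)).
Proof.
rewrite pairwise_map; have := iota_uniq k n; rewrite uniq_pairwise.
apply: sub_pairwise => i j ij /=.
by rewrite /b e_eigen ipZ e_orth// mulr0.
Qed.

Lemma sumsq_energy n w : sumsq X (map e (iota 0 n)) w = energy ip e n (xi w).
Proof. by rewrite /sumsq /energy big_map /index_iota subn0. Qed.

Lemma laplace_coordinate h :
  \int[P]_w expR (- (ip (xi w) h ^+ 2 / 2)) = (Num.sqrt (1 + b h h))^-1.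
Proof.
have := Rintegral_expRN_sumsq mX XD bC bD b_ge0 lawX (t := 1) (s := [:: h]) ler01 erefl.
rewrite big_seq1 mul1r => <-; apply: eq_Rintegral => w _.
by rewrite /sumsq big_seq1 mul1r.
Qed.

Lemma prodr1D_ge n (x : nat -> R) : (forall j, 0 <= x j) ->
  \sum_(0 <= j < n) x j <= \prod_(0 <= j < n) (1 + x j).
Proof.
move=> x0; suff : 1 + \sum_(0 <= j < n) x j <= \prod_(0 <= j < n) (1 + x j).
  by apply: le_trans; rewrite lerDr.
elim: n => [|n IH]; first by rewrite !big_geq// addr0.
rewrite !big_nat_recr//=.
have : 0 <= \sum_(0 <= j < n) x j by apply: sumr_ge0.
have := x0 n; nra.
Qed.

(** [E exp (- |xi| ^ 2 / 2)] is positive, and for every [n] it is at most the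
    product of the first [n] factors [(1 + lam j) ^ (- 1 / 2)]. *)
Lemma eigenvalue_sum_bounded : exists K : R,
  forall n, \sum_(0 <= j < n) lam j <= K.
Proof.
pose c := \int[P]_w expR (- (`|xi w| ^+ 2 / 2)).
have mnorm : measurable_fun setT (fun w => expR (- (`|xi w| ^+ 2 / 2))).
  apply: measurableT_comp => //; apply: measurableT_comp => //.
  apply: measurable_funM => //; apply: measurable_funX.
  apply: (measurable_comp_element hgauss); exact: norm_continuous.
have le1 (x : R) : 0 <= x -> `|expR (- (x / 2))| <= 1.
  move=> x0; rewrite ger0_norm ?expR_ge0// -expR0 ler_expR oppr_le0.
  by rewrite divr_ge0.
have c0 : 0 < c.
  rewrite lt_neqAle; apply/andP; split; last by apply: Rintegral_ge0 => w _; exact: expR_ge0.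
  apply/negP => /eqP c0.
  have ci : P.-integrable setT (fun w => (expR (- (`|xi w| ^+ 2 / 2)))%:E).
    by apply: (@prob_integrable _ _ _ P _ 1) => // w; rewrite le1 ?sqr_ge0.
  have I0 : (\int[P]_w `|(expR (- (`|xi w| ^+ 2 / 2)))%:E| = 0)%E.
    under eq_integral do rewrite gee0_abs ?lee_fin ?expR_ge0//.
    by rewrite -[LHS]fineK ?integrable_fin_num// -[fine _]/c -c0.
  have /(ae_eq_integral_abs _ measurableT)[] := I0.
    exact/measurable_EFinP.
  move=> N [mN PN sN]; have NT : N = setT.
    apply/seteqP; split => // w _; apply: sN => /= h.
    by have [/eqP] := h Logic.I; rewrite gt_eqF ?expR_gt0.
  have : (1 = 0 :> \bar R)%E by rewrite -(probability_setT P) -[RHS]PN NT.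
  by move=> /eqP; rewrite onee_eq0.
exists (c ^- 2) => n.
apply: (le_trans (prodr1D_ge n eigenvalue_ge0)).
have pos j : 0 < 1 + lam j by rewrite ltr_pwDl// eigenvalue_ge0.
have : c <= \prod_(0 <= j < n) (Num.sqrt (1 + lam j))^-1.
  have := Rintegral_expRN_sumsq mX XD bC bD b_ge0 lawX (t := 1)
    (s := map e (iota 0 n)) ler01 (eigenvectors_b_orth 0 n).
  rewrite big_map; under eq_bigr do rewrite mul1r eigen_form.
  rewrite -[in iota 0 n](subn0 n) => <-.
  apply: (@le_Rintegral_prob _ _ _ P _ _ 1) => //.
  - apply: measurableT_comp => //; apply: measurableT_comp => //.
    apply: measurable_funM => //; apply: measurable_funM => //.
    exact: measurable_sumsq.
  - by move=> w; rewrite le1// sqr_ge0.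
  - by move=> w; rewrite le1// mul1r sumsq_ge0.
  - move=> w; rewrite ler_expR lerN2 mul1r ler_pM2r ?invr_gt0// subn0 sumsq_energy.
    exact: (energy_le ipE e_norm e_orth).
have -> : \prod_(0 <= j < n) (Num.sqrt (1 + lam j))^-1 =
    (Num.sqrt (\prod_(0 <= j < n) (1 + lam j)))^-1.
  elim: n => [|n IH]; first by rewrite !big_geq// sqrtr1 invr1.
  rewrite !big_nat_recr//= IH sqrtrM ?invfM//.
  by apply: prodr_ge0 => j _; exact: ltW.
set p := \prod_(_ <= _ < _) _; have p0 : 0 < p by apply: prodr_gt0.
move=> cp; rewrite -[leLHS]invrK lef_pV2 ?posrE ?invr_gt0 ?exprn_gt0//.
have -> : p^-1 = (Num.sqrt p)^-1 ^+ 2 by rewrite exprVn sqr_sqrtr// ltW.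
by rewrite ler_sqr ?nnegrE ?invr_ge0 ?sqrtr_ge0// ltW.
Qed.

Lemma eigenvalue_cvg0 : lam n @[n --> \oo] --> 0.
Proof.
have [K hK] := eigenvalue_sum_bounded.
apply: (@cvg_series_cvg_0 R (R^o)).
apply: nondecreasing_is_cvgn.
  by apply/nondecreasing_seqP => n; rewrite seriesSr lerDl eigenvalue_ge0.
by exists K => _ [n _ <-]; exact: hK.
Qed.

Lemma Sigma_residual n u : Sigma (residual ip e n u) = residual ip e n (Sigma u).
Proof.
elim: n => [//|n IH] /=.
rewrite linearB linearZ/= IH e_eigen scalerA; congr (_ - _ *: _).
by rewrite (covariance_sym hcov) e_eigen ipZr mulrC.
Qed.

(** If nonzero, the norm of the residual covariance is an eigenvalue of it. An
    eigenvector for it is orthogonal to the first [n] vectors [e j], hence an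
    eigenvector of [Sigma], and by exhaustion its eigenvalue is [lam j] for some
    [j >= n]. *)
Lemma residual_form_le n u :
  b (residual ip e n u) (residual ip e n u) <= lam n * `|u| ^+ 2.
Proof.
pose Q := residual ip e n; pose A v := Sigma (Q v).
have QD := residualD ip e n.
have Qsym := residual_sym ipE e_norm e_orth n.
have AE v : ip (A v) v = b (Q v) (Q v).
  rewrite /A /b /Q Sigma_residual Qsym.
  by rewrite (residual_ip_residual ipE e_norm e_orth)// -Qsym.
have [M M0 hM] := covariance_bounded ipE hcov.
have [pos|/forallNP neg] := pselect (exists v, 0 < ip (A v) v); last first.
  have /negP := neg u; rewrite -leNgt AE => h.
  by rewrite (le_trans h)// mulr_ge0 ?eigenvalue_ge0// sqr_ge0.
have [m [m0 hm [z z0 Az]]] : exists m : R, [/\ 0 < m,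
    (forall u, ip (A u) u <= m * `|u| ^+ 2) & exists2 z, z != 0 & A z = m *: z].
  refine (@covariance_eigenvector R H ip ipE _ _ P (fun w => Q (xi w)) A M
    _ _ _ _ _ _ pos).
  - by move=> c v w; rewrite /A /Q QD linearD linearZ.
  - by move=> v w; rewrite /A (covariance_sym hcov) /Q Qsym Sigma_residual.
  - by move=> v; rewrite AE.
  - move=> v; rewrite AE; apply: (le_trans (hM _)); rewrite ler_wpM2l//.
    by rewrite ler_sqr ?nnegrE// (residual_le ipE e_norm e_orth).
  - move=> f cf; apply: (measurable_comp_element hgauss (f := f \o Q)).
    by move=> v; apply: continuous_comp; [exact: (residual_continuous ipE e_norm e_orth)|exact: cf].
  - move=> h; rewrite AE -laplace_coordinate.
    by apply: eq_Rintegral => w _; rewrite /Q Qsym.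
have zr : forall j, (j < n)%N -> ip z (e j) = 0.
  move=> j jn; have : ip (m *: z) (e j) = 0.
    by rewrite -Az /A /Q Sigma_residual (residual_ip ipE e_norm e_orth) jn.
  by rewrite ipZ => /eqP; rewrite mulf_eq0 gt_eqF//= => /eqP.
have Qz : Q z = z.
  have E k : (k <= n)%N -> residual ip e k z = z.
    elim: k => [//|k IH] kn /=.
    by rewrite IH ?(ltnW kn)// zr// scale0r subr0.
  exact: E.
have Sz : Sigma z = m *: z by rewrite -Az /A Qz.
have [j zj] : exists j, ip z (e j) != 0.
  apply: contrapT => /forallNP h; move/negP: z0; apply; apply/eqP.
  apply: (e_exhaust (lt0r_neq0 m0) Sz) => j.
  by apply/eqP/negPn/negP; exact: h.
have jm : lam j = m.
  apply/eqP; apply: contrapT => /negP jm; move/negP: zj; apply; apply/eqP.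
  apply: (eigenvectors_orthogonal (covariance_sym hcov) _ Sz (e_eigen j)).
  by rewrite eq_sym.
have nj : (n <= j)%N.
  by rewrite leqNgt; apply/negP => /zr h; rewrite h eqxx in zj.
rewrite -AE (le_trans (hm u))// ler_wpM2r ?sqr_ge0// -jm.
exact: lam_noninc.
Qed.

(** The variance of [<residual n xi, h>] is at most [lam n * |h| ^ 2] and tends
    to zero; so [E exp (- s ^ 2 / 2) = 1] for the limit [s]. *)
Lemma ae_coordinate_limit h :
  {ae P, forall w, ip (limn (fun n => residual ip e n (xi w))) h = 0}.
Proof.
pose zeta w := limn (fun n => residual ip e n (xi w)).
pose f n w := expR (- (ip (residual ip e n (xi w)) h ^+ 2 / 2)).
pose g w := expR (- (ip (zeta w) h ^+ 2 / 2)).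
have fg w : f n w @[n --> \oo] --> g w.
  apply: (continuous_cvg _ (@continuous_expR _ _)).
  apply: cvgN; apply: cvgM; last exact: cvg_cst.
  have c : ip (residual ip e n (xi w)) h @[n --> \oo] --> ip (zeta w) h.
    have hc : residual ip e n (xi w) @[n --> \oo] --> zeta w.
      exact: (@residual_is_cvg _ _ _ ipE _ _ e_norm e_orth (xi w)).
    exact: (cvg_comp _ _ hc (ip_continuous ipE (v := h) (x := zeta w))).
  by under eq_fun do rewrite expr2; rewrite expr2; exact: cvgM.
have mf n : measurable_fun setT (f n).
  apply: measurableT_comp => //; apply: measurableT_comp => //.
  apply: measurable_funM => //; apply: measurable_funX.
  rewrite (_ : (fun w => _) = X (residual ip e n h)); first exact: mX.
  by apply/funext => w; rewrite /X (residual_sym ipE e_norm e_orth).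
have mg : measurable_fun setT g.
  exact: (measurable_fun_cvg mf (fun w _ => fg w)).
have le1 (x : R) : `|expR (- (x ^+ 2 / 2))| <= 1.
  rewrite ger0_norm ?expR_ge0// -expR0 ler_expR oppr_le0.
  by rewrite divr_ge0// sqr_ge0.
have fi n : P.-integrable setT (fun w => (f n w)%:E).
  by apply: (@prob_integrable _ _ _ P _ 1) => // w; exact: le1.
have gi : P.-integrable setT (fun w => (g w)%:E).
  by apply: (@prob_integrable _ _ _ P _ 1) => // w; exact: le1.
have lim_g : (\int[P]_w (f n w)%:E)%E @[n --> \oo] --> (\int[P]_w (g w)%:E)%E.
  have [] := @dominated_convergence _ T _ P setT measurableT
    (fun n w => (f n w)%:E) (fun w => (g w)%:E) (cst 1%E).
  - by move=> n; exact/measurable_EFinP.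
  - exact/measurable_EFinP.
  - by apply/aeW => w _; apply: cvg_EFin; [exact: nearW|exact: fg].
  - exact: finite_measure_integrable_cst.
  - by apply/aeW => w n _; rewrite lee_fin; exact: le1.
  by [].
pose q n := b (residual ip e n h) (residual ip e n h).
have q0 : q n @[n --> \oo] --> 0.
  apply: (@squeeze_cvgr _ _ _ _ (cst 0) (fun n => lam n * `|h| ^+ 2)).
  - by apply: nearW => n; rewrite /q b_ge0 residual_form_le.
  - exact: cvg_cst.
  - rewrite -[X in _ --> X](mul0r (`|h| ^+ 2)).
    by apply: cvgM; [exact: eigenvalue_cvg0|exact: cvg_cst].
have int_f n : (\int[P]_w (f n w)%:E = ((Num.sqrt (1 + q n))^-1)%:E)%E.
  rewrite -laplace_coordinate -[LHS](fineK (integrable_fin_num measurableT (fi n))).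
  congr EFin.
  rewrite -[LHS]/(Rintegral _ _ _); apply: eq_Rintegral => w _.
  by rewrite /f (residual_sym ipE e_norm e_orth).
have lim1 : (\int[P]_w (f n w)%:E)%E @[n --> \oo] --> 1%E.
  under eq_fun do rewrite int_f.
  apply: cvg_EFin; first exact: nearW.
  rewrite -[X in _ --> X](_ : (Num.sqrt (1 + 0))^-1 = 1 :> R); last first.
    by rewrite addr0 sqrtr1 invr1.
  apply: cvgV; first by rewrite addr0 sqrtr1 oner_eq0.
  apply: (continuous_cvg _ (@sqrt_continuous _ _)).
  by apply: cvgD => //; exact: cvg_cst.
have int_g : (\int[P]_w (g w)%:E = 1)%E.
  by rewrite -(cvg_lim _ lim_g)// (cvg_lim _ lim1).
have I0 : (\int[P]_w `|(1 - g w)%:E| = 0)%E.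
  have g1 w : 0 <= 1 - g w.
    by rewrite subr_ge0; apply: le_trans (le1 (ip (zeta w) h)); exact: ler_norm.
  under eq_integral do rewrite gee0_abs ?lee_fin ?g1// EFinB.
  rewrite integralB// ?int_g ?integral_prob_cst ?subee//.
  exact: finite_measure_integrable_cst.
have : ae_eq P setT (fun w => (1 - g w)%:E) (cst 0%E).
  apply/(ae_eq_integral_abs _ measurableT) => //.
  by apply/measurable_EFinP; exact: measurable_funB.
apply: filterS => w /(_ Logic.I) [] /eqP; rewrite subr_eq0 eq_sym => /eqP.
rewrite /g -expR0 => /expR_inj /eqP; rewrite oppr_eq0 mulf_eq0 => /orP[|].
  by rewrite sqrf_eq0 => /eqP.
by rewrite gt_eqF ?invr_gt0.
Qed.

(** Almost surely, the limit of the residuals is orthogonal to all points of a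
    countable dense set, hence zero. *)
Lemma ae_energy_cvg : separable_space H ->
  {ae P, forall w, energy ip e n (xi w) @[n --> \oo] --> `|xi w| ^+ 2}.
Proof.
move=> [D /pfcard_geP[D0|[g]] dD].
  have [] := dD setT; first by exists 0.
    exact: openT.
  by move=> v []; rewrite D0.
have surj_g v : D v -> exists n, g n = v.
  by move=> Dv; have [n _ <-] := @surj _ _ _ _ g v Dv; exists n.
have := ae_foralln (fun n => ae_coordinate_limit (g n)).
apply: filterS => w hw; apply: (energy_cvg ipE e_norm e_orth).
set zeta := limn _; apply/eqP; apply: contrapT => /negP z0.
have nz : 0 < `|zeta| by rewrite normr_gt0.
have [v Dv zv] := dense_approx dD zeta nz.
have [n gn] := surj_g v Dv.
have zv0 : ip zeta v = 0 by rewrite -gn; exact: hw.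
have : ip zeta (zeta - v) <= `|zeta| * `|zeta - v|.
  by apply: le_trans (ip_cauchy_schwarz ipE _ _); exact: ler_norm.
rewrite (ipBr ip) zv0 subr0 -ipE expr2 ler_pM2l// leNgt.
by rewrite zv.
Qed.

Lemma norm_concentration_limit (lo hi K : R) : separable_space H ->
  (forall n, P [set w | (lo < sumsq X (map e [:: 0, 1 & iota 2 n]%N) w < hi)%R]
    <= K%:E)%E ->
  (P [set w | (lo < `|xi w| ^+ 2 < hi)%R] <= K%:E)%E.
Proof.
move=> hsep hK; pose S n w := sumsq X (map e (iota 0 n)) w.
have SE n w : S n w = energy ip e n (xi w) by exact: sumsq_energy.
apply: (@prob_oo_limit_le _ _ _ P S).
- by move=> n; exact: measurable_sumsq.
- apply: measurable_funX; apply: (measurable_comp_element hgauss).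
  exact: norm_continuous.
- by move=> w i j ij; rewrite !SE; exact: energy_nondecreasing.
- by move=> n w; rewrite SE; exact: (energy_le ipE e_norm e_orth).
- apply: filterS (ae_energy_cvg hsep) => w.
  by rewrite (_ : S ^~ w = fun n => energy ip e n (xi w)) //; apply/funext => n.
- exists 2%N => // n /= n2; rewrite -(subnK n2) addnC; exact: hK.
Qed.

Lemma norm_concentration (lo hi : R) : separable_space H -> 0 < lam 1%N -> lo < hi ->
  (P [set w | (lo < `|xi w| ^+ 2 < hi)%R]
   <= ((hi - lo) / Num.sqrt (lam 0%N * lam 1%N))%:E)%E.
Proof.
move=> hsep l1 lohi; apply: norm_concentration_limit => // n.
have := sumsq_concentration mX XD bC bD b_ge0 lawX (e0 := e 0%N) (e1 := e 1%N)
  (s := map e (iota 2 n)) (lo := lo) (hi := hi) (eigenvectors_b_orth 0 n.+2).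
by rewrite !eigen_form; apply => //; exact: lam_noninc.
Qed.

Lemma norm_concentration_exp (lo hi l : R) : separable_space H ->
  0 < lam 1%N -> lo < hi -> lam 0%N < l ->
  (P [set w | (lo < `|xi w| ^+ 2 < hi)%R]
   <= ((hi - lo) / Num.sqrt (lam 0%N * lam 1%N)
       * (expR (- (lo / (2 * l))) * limn (tail_prod lam l)))%:E)%E.
Proof.
move=> hsep l1 lohi l0; apply: norm_concentration_limit => // n.
have := sumsq_concentration_exp mX XD bC bD b_ge0 lawX (e0 := e 0%N) (e1 := e 1%N)
  (s := map e (iota 2 n)) (lo := lo) (hi := hi) (l := l) (eigenvectors_b_orth 0 n.+2).
rewrite !eigen_form => /(_ l1 (lam_noninc (leq0n 1)) lohi l0) h.
apply: le_trans (h _) _.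
  by apply/allP => _ /mapP[j _ ->]; rewrite eigen_form (le_lt_trans _ l0)// lam_noninc.
rewrite lee_fin ler_wpM2l ?ler_wpM2l ?expR_ge0//.
  by rewrite divr_ge0// subr_ge0 ltW.
apply: le_trans (tail_prod_le_limn lam_noninc eigenvalue_ge0 eigenvalue_sum_bounded l0 n.+2).
rewrite /tail_prod big_map /index_iota subn2 /=.
rewrite le_eqVlt; apply/orP; left; apply/eqP; apply: eq_bigr => j _.
by rewrite eigen_form -(tail_prod_factorE lam_noninc eigenvalue_ge0 l0).
Qed.

Lemma eigenvalue_tail_prod (l : R) : lam 0%N < l ->
  cvgn (tail_prod lam l) /\ 0 < limn (tail_prod lam l).
Proof.
move=> l0; split.
  exact: (@tail_prod_is_cvg _ _ _ lam_noninc eigenvalue_ge0 eigenvalue_sum_bounded l0).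
exact: (limn_tail_prod_gt0 lam_noninc eigenvalue_ge0 eigenvalue_sum_bounded l0).
Qed.

End spectrum.

Theorem lemma5p4 (R : realType) (d : measure_display) (T : measurableType d)
    (P : probability T R) (H : completeNormedModType R)
    (ip : {dot H for @idfun R}) (xi : T -> H) (Sigma : {linear H -> H})
    (lam : R^nat)
    (hH : separable_hilbert ip)
    (hgauss : gaussian_element P ip xi)
    (hmean : zero_mean P ip xi)
    (hcov : covariance_operator P ip xi Sigma)
    (hlam : eigenvalue_sequence Sigma lam) :
  (forall x Delta l : R, 0 < x -> 0 < Delta -> lam 0%N < l ->
     cvgn (tail_prod lam l) /\
     (P [set w | (x < `|xi w| ^+ 2 < x + Delta)%R]
        <= C1 lam l x * Delta%:E)%E) /\
  (forall Delta : R, 0 < Delta ->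
     (ereal_sup [set P [set w | (x < `|xi w| ^+ 2 < x + Delta)%R]
                | x in [set x : R | (0 < x)%R]]
        <= Delta%:E / (Num.sqrt (lam 0%N * lam 1%N))%:E)%E).
Proof.
have [ipE hsep] := hH; have lam_noninc := hlam.1.
have [e [e_eigen e_norm e_orth e_exhaust]] :=
  eigenvector_system ipE (covariance_sym hcov) hlam.
have lam_ge0 := eigenvalue_ge0 hcov e_eigen e_norm.
have tail := eigenvalue_tail_prod ipE hgauss hmean hcov lam_noninc e_eigen e_norm e_orth.
have bound := norm_concentration ipE hgauss hmean hcov lam_noninc e_eigen e_norm
  e_orth e_exhaust.
have bound_exp := norm_concentration_exp ipE hgauss hmean hcov lam_noninc e_eigen
  e_norm e_orth e_exhaust.
have [lam1|lam1] : lam 1%N = 0 \/ 0 < lam 1%N.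
  by case: (ltgtP 0 (lam 1%N)) (lam_ge0 1%N) => // *; [right|left].
(* Both bounds are infinite, the numerators being positive. *)
- split=> [x Delta l x0 D0 lam0l|Delta D0]; last first.
    by rewrite lam1 mulr0 sqrtr0 inve0 gt0_muley ?lte_fin// leey.
  split; first exact: (tail l lam0l).1.
  rewrite /C1 lam1 mulr0 sqrtr0 inve0 gt0_muley ?lte_fin ?expR_gt0//.
  by rewrite gt0_mulye ?lte_fin ?(tail l lam0l).2// gt0_mulye ?lte_fin// leey.
have s0 : Num.sqrt (lam 0%N * lam 1%N) != 0.
  rewrite gt_eqF// sqrtr_gt0 mulr_gt0// (lt_le_trans lam1)//.
  exact: lam_noninc.
split=> [x Delta l x0 D0 lam0l|Delta D0].
  split; first exact: (tail l lam0l).1.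
  have := bound_exp x (x + Delta) l hsep lam1 _ lam0l.
  rewrite ltrDl D0 => /(_ isT) h; apply: (le_trans h).
  rewrite /C1 inver (negbTE s0) -!EFinM lee_fin addrAC subrr add0r.
  rewrite le_eqVlt; apply/orP; left; apply/eqP; ring.
apply: ge_ereal_sup => _ [x x0 <-].
have := bound x (x + Delta) hsep lam1; rewrite ltrDl => /(_ D0).
by rewrite addrAC subrr add0r inver (negbTE s0).
Qed.
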